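(* Let $w_1,w_2,w_3,w_4$ be pairwise disjoint non-trivial words. Let $w=w_1w_2w_3w_4$ and $G=\mathrm{PSL}_2(q)$, where $q$ ranges over prime powers. Then $$\lim_{q\to\infty}\Vert p_{w,G}-U_G\Vert_{L^\infty}=0.$$
   Context: A word is an element of a free group $F_d$ on $x_1,\ldots,x_d$; words are pairwise disjoint if they are words in pairwise disjoint sets of variables. A word $w\in F_d$ induces by substitution a word map $w\colon G^d\to G$. For a finite group $G$, $p_{w,G}(\{g\})=|w^{-1}(g)|/|G|^d$ and $U_G$ is the uniform distribution on $G$. For a real function $f$ on $G$, $\Vert f\Vert_{L^\infty}=|G|\cdot\max_{g\in G}|f(g)|$ (distributions are identified with their point-mass functions). *)

(* Defs.v *)
From HB Require Import structures.
From mathcomp Require Import all_boot all_order all_algebra all_fingroup.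
From mathcomp Require Import all_solvable.

Set Implicit Arguments.
Unset Strict Implicit.
Unset Printing Implicit Defensive.

Import Order.TTheory GRing.Theory Num.Theory GroupScope.

(* The free group F_d on x_0, ..., x_(d-1), as the group of reduced sequences  *)
(* of letters: (i, false) stands for x_i and (i, true) for x_i^-1.             *)

Definition letter (d : nat) := ('I_d * bool)%type.

Section Letters.
Variable d : nat.
Implicit Types (a b : letter d) (s t u : seq (letter d)).

Definition linv a : letter d := (a.1, ~~ a.2).

Definition reduced s := sorted (fun a b => b != linv a) s.

(* Reduced form of a :: s, for s reduced. *)
Definition push a s :=
  if s is b :: s' then if b == linv a then s' else a :: s else [:: a].

Definition word_mul s t := foldr push t s.

Definition word_inv s := rev (map linv s).

Lemma linvK : involutive linv.
Proof. by case=> i b; rewrite /linv /= negbK. Qed.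

Lemma reduced_cons a s : reduced (a :: s) -> reduced s.
Proof. by case: s => //= b s /andP[]. Qed.

Lemma push_reduced a s : reduced s -> reduced (push a s).
Proof.
case: s => //= b s rs; case: ifP => [_|/negbT ab] /=.
  exact: (@reduced_cons b).
by rewrite ab.
Qed.

Lemma push_cons a s : reduced (a :: s) -> push a s = a :: s.
Proof. by case: s => //= b s /andP[/negPf->]. Qed.

Lemma pushK a s : reduced s -> push a (push (linv a) s) = s.
Proof.
case: s => [|b s] rs; first by rewrite /push eqxx.
rewrite [push (linv a) _]/= linvK; case: (b =P a) => [ba|_].
  by rewrite -ba; exact: push_cons.
by rewrite /push eqxx.
Qed.

Lemma mul_reduced s t : reduced t -> reduced (word_mul s t).
Proof. by move=> rt; elim: s => //= a s; apply: push_reduced. Qed.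

Lemma inv_reduced s : reduced s -> reduced (word_inv s).
Proof.
rewrite /reduced rev_sorted; case: s => //= a s; rewrite path_map.
apply: sub_path => b c /=; apply: contra => /eqP eqb.
by rewrite -(linvK c) -eqb.
Qed.

Lemma push_mul a s t :
  reduced s -> reduced t -> word_mul (push a s) t = push a (word_mul s t).
Proof.
case: s => //= b s rs rt; case: ifP => [/eqP->|_ //].
by rewrite pushK //; apply: mul_reduced.
Qed.

Lemma word_mulA s t u :
  reduced t -> reduced u ->
  word_mul s (word_mul t u) = word_mul (word_mul s t) u.
Proof.
by move=> rt ru; elim: s => //= a s ->; rewrite push_mul ?mul_reduced.
Qed.

Lemma word_mul1 s : reduced s -> word_mul s [::] = s.
Proof.
by elim: s => //= a s IHs rs; rewrite IHs ?push_cons // (@reduced_cons a).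
Qed.

Lemma word_mulVg s : reduced s -> word_mul (word_inv s) s = [::].
Proof.
elim: s => // a s IHs rs; rewrite /word_inv /= rev_cons /word_mul foldr_rcons.
by rewrite /= linvK eqxx; exact/IHs/(reduced_cons rs).
Qed.

Lemma word_mulgV s : reduced s -> word_mul s (word_inv s) = [::].
Proof.
move=> rs; rewrite -[X in word_mul X _](_ : word_inv (word_inv s) = s).
  by apply: word_mulVg; apply: inv_reduced.
by rewrite /word_inv map_rev revK mapK //; apply: linvK.
Qed.

End Letters.

Record free_group (d : nat) := FreeGroup {
  letters :> seq (letter d);
  _ : reduced letters
}.

HB.instance Definition _ d := [isSub for @letters d].
HB.instance Definition _ d := [Choice of free_group d by <:].

Section FreeGroup.
Variable d : nat.
Implicit Types w : free_group d.

Definition fg_one : free_group d := @FreeGroup d [::] isT.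
Definition fg_mul w1 w2 := FreeGroup (mul_reduced w1 (valP w2)).
Definition fg_inv w := FreeGroup (inv_reduced (valP w)).

Fact fg_mulA : associative fg_mul.
Proof.
move=> w1 w2 w3; apply/val_inj.
by rewrite /= word_mulA //; apply: valP.
Qed.

Fact fg_mul1g : left_id fg_one fg_mul.
Proof. by move=> w; apply/val_inj. Qed.

Fact fg_mulg1 : right_id fg_one fg_mul.
Proof. by move=> w; apply/val_inj; rewrite /= word_mul1 //; apply: valP. Qed.

Fact fg_mulVg : left_inverse fg_one fg_inv fg_mul.
Proof. by move=> w; apply/val_inj; rewrite /= word_mulVg //; apply: valP. Qed.

Fact fg_mulgV : right_inverse fg_one fg_inv fg_mul.
Proof. by move=> w; apply/val_inj; rewrite /= word_mulgV //; apply: valP. Qed.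

HB.instance Definition _ := isGroup.Build (free_group d)
  fg_mulA fg_mul1g fg_mulg1 fg_mulVg fg_mulgV.

End FreeGroup.

(* w is a word in the variables x_i, i \in X, i.e. w lies in the subgroup of  *)
(* F_d that they generate: its reduced form uses no other variable.           *)
Definition word_in (d : nat) (X : {set 'I_d}) (w : free_group d) : bool :=
  all (fun a => a.1 \in X) (letters w).

Definition pairwise_disjoint_words (d : nat) (ws : seq (free_group d)) : Prop :=
  exists2 Xs : seq {set 'I_d},
    all2 (@word_in d) Xs ws &
    pairwise (fun X Y : {set 'I_d} => [disjoint X & Y]) Xs.

Definition word_map (d : nat) (gT : groupType) (w : free_group d)
    (t : 'I_d -> gT) : gT :=
  \prod_(a <- letters w) (if a.2 then (t a.1)^-1 else t a.1).

(* Real functions on a group G : {group gT} are represented by functions on   *)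
(* gT, of which only the values on G are relevant.                            *)

Definition word_dist (R : realFieldType) (gT : finGroupType) (G : {group gT})
    (d : nat) (w : free_group d) (g : gT) : R :=
  (#|[set t : {ffun 'I_d -> gT} in ffun_on G | word_map w t == g]|%:R
   / #|G|%:R ^+ d)%R.

Definition unif_dist (R : realFieldType) (gT : finGroupType) (G : {group gT})
    (g : gT) : R :=
  if g \in G then (#|G|%:R^-1)%R else 0%R.

Definition Linfty_norm (R : realFieldType) (gT : finGroupType) (G : {group gT})
    (f : gT -> R) : R :=
  (#|G|%:R * \big[Num.max/0]_(g in G) `|f g|)%R.

Section PSL2.
Variable F : finFieldType.

Definition SL2_set : {set {'GL_2[F]}} := [set A | (\det (GLval A) == 1)%R].

Fact SL2_group_set : group_set SL2_set.
Proof.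
apply/group_setP; split=> [|A B]; rewrite !inE; first by rewrite GL_1E det1.
by move=> /eqP dA /eqP dB; rewrite GL_ME det_mulmx dA dB mulr1.
Qed.

Definition SL2 : {group {'GL_2[F]}} := Group SL2_group_set.

Definition PSL2 : {group coset_of 'Z(SL2)} := (SL2 / 'Z(SL2))%G.

End PSL2.

Definition prime_power (q : nat) : Prop :=
  exists p k : nat, [/\ prime p, (0 < k)%N & q = (p ^ k)%N].

(* Main.v *)
Require Import Defs.
From mathcomp Require Import all_boot all_order all_algebra all_fingroup.
From mathcomp Require Import all_solvable ring lra.

Import Order.TTheory GRing.Theory Num.Theory.
Set Implicit Arguments.
Unset Strict Implicit.
Unset Printing Implicit Defensive.
Local Open Scope ring_scope.

(* The statement lifts to S = SL_2(q), of order N = q^3 - q, where it is shown *)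
(* with error O(q^(-1/2)).                                                     *)
(* (1) tr(w(t)) = c has probability O(1/q) for t uniform in S^d. After cyclic  *)
(* reduction of w, write t_i = h(i,0) u(x) h(i,1)^-1 with u(x) upper           *)
(* unipotent, and x and the h's uniform: tr(w(t)) is a polynomial in x, whose  *)
(* leading coefficient is a product of matrix entries, each of which vanishes  *)
(* with probability O(1/q).                                                    *)
(* (2) Noncentral elements of S with the same trace are conjugate in GL_2, and *)
(* there are about q^2 of them, so the distribution of w is a(tr g) with       *)
(* a = O(q^-3) off the center, and O(1/q) on the center.                       *)
(* (3) For noncentral g, the number of x in S with given tr(x) and tr(xg) is   *)
(* the number of points of an affine conic; its second moment shows that it is *)
(* q + O(q^(1/2)) on average. Hence the convolution of two distributions as in *)
(* (2) is (1 + O(q^(-1/2)))/N off the center, and O(q^-2) on it.               *)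
(* (4) The convolution of two functions as in (3) is uniform up to             *)
(* O(q^(-1/2))/N everywhere.                                                   *)

(** * Word maps and word distributions *)

(** The quantity to control is the density [#|G| * word_dist], which has to be close to 1 at every
    point. Passing from SL_2 to PSL_2 only averages it over cosets of the center
    ([Linfty_word_dist_quotient]), so a bound on SL_2(q) suffices.

    There a single word has two usable properties. Its distribution is invariant under conjugation
    by GL_2, hence depends only on the trace off the center; and no trace value has probability more
    than O(1/q) ([card_trace_word]). Together they give [traceform_word]. Such a distribution can be
    far from uniform: trace classes may be weighted unevenly by bounded factors, and a central
    element may have mass of order 1/q.

    A product of two independent such elements repairs the first defect. For noncentral g the pair
    (tr x, tr(xg)) is nearly equidistributed in F^2 ([sum_SL2_equidist]), so the convolution at g
    splits into a product of two total masses ([conv_nearly_uniform]). For central g the two traces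
    determine each other, and only an upper bound O(q^-2) survives. A second convolution removes
    this remaining defect, since at most four of its terms involve a central element
    ([conv_uniform]). This is how four words enter. The constants depend only on the lengths of the
    words, and r stands for the square root of q throughout. *)

Section WordMap.
Variables (d : nat) (gT : groupType).
Implicit Types (t : 'I_d -> gT) (s : seq (letter d)).

Definition letter_val t (a : letter d) : gT :=
  if a.2 then (t a.1)^-1%g else t a.1.

Definition seq_val t s : gT := (\prod_(a <- s) letter_val t a)%g.

Lemma word_mapE (w : free_group d) t : word_map w t = seq_val t (letters w).
Proof. by []. Qed.

Lemma seq_val_cons t a s : seq_val t (a :: s) = (letter_val t a * seq_val t s)%g.
Proof. by rewrite /seq_val big_cons. Qed.

Lemma letter_val_linv t a : letter_val t (linv a) = (letter_val t a)^-1%g.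
Proof. by rewrite /letter_val /linv /=; case: a.2; rewrite ?invgK. Qed.

Lemma seq_val_push t a s : seq_val t (push a s) = (letter_val t a * seq_val t s)%g.
Proof.
case: s => [|b s] /=; first by rewrite seq_val_cons.
case: eqP => [->|_]; last by rewrite seq_val_cons.
by rewrite seq_val_cons letter_val_linv mulgA mulgV mul1g.
Qed.

Lemma word_mapM (u v : free_group d) t :
  word_map (u * v)%g t = (word_map u t * word_map v t)%g.
Proof.
rewrite !word_mapE /= /word_mul; elim: (letters u) => [|a s IHs] /=.
  by rewrite {2}/seq_val big_nil mul1g.
by rewrite seq_val_push IHs seq_val_cons mulgA.
Qed.

Lemma eq_word_map (X : {set 'I_d}) (w : free_group d) t1 t2 :
  word_in X w -> {in X, t1 =1 t2} -> word_map w t1 = word_map w t2.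
Proof.
move=> /allP wX eqt; rewrite !word_mapE; apply: eq_big_seq => a /wX aX.
by rewrite /letter_val eqt.
Qed.

Lemma word_inM (X Y : {set 'I_d}) (u v : free_group d) :
  word_in X u -> word_in Y v -> word_in (X :|: Y) (u * v)%g.
Proof.
rewrite /word_in /= /word_mul => uX vY.
elim: (letters u) uX => [_|a s IHs /andP[aX /IHs]] /=.
  by apply: sub_all vY => a aY; rewrite inE aY orbT.
have aXY: a.1 \in X :|: Y by apply/setUP; left.
case: (foldr (@push d) _ _) => [|b r] /=; first by move=> _; apply/andP.
by case: eqP => [_ /andP[]|_ rXY] //=; apply/andP.
Qed.

End WordMap.

(** The predicate [P] is there for [coset H], which is multiplicative only on the normalizer of
    [H]. *)
Lemma morph_word_map (d : nat) (gT rT : groupType) (f : gT -> rT)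
    (w : free_group d) (t : 'I_d -> gT) (P : pred gT) :
  P 1%g -> (forall x y, P x -> P y -> P (x * y)%g) ->
  (forall x, P x -> P (x^-1)%g) ->
  f 1%g = 1%g -> (forall x y, P x -> P y -> f (x * y) = f x * f y)%g ->
  (forall x, P x -> f x^-1 = (f x)^-1)%g ->
  (forall i, P (t i)) -> 
  word_map w (f \o t) = f (word_map w t).
Proof.
move=> P1 PM PV f1 fM fV Pt; rewrite !word_mapE.
suff [] : P (seq_val t (letters w)) /\
  seq_val (f \o t) (letters w) = f (seq_val t (letters w)) by [].
have Pl a : P (letter_val t a) by rewrite /letter_val; case: a.2; auto.
elim: (letters w) => [|a s [Ps IHs]]; first by rewrite /seq_val !big_nil.
rewrite !seq_val_cons IHs; split; first exact: PM.
by rewrite fM //; congr (_ * _)%g; rewrite /letter_val; case: a.2; rewrite ?fV.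
Qed.

Section WordDist.
Variables (R : realFieldType) (gT : finGroupType) (d : nat).
Implicit Types (G H : {group gT}) (w u v : free_group d).

Lemma word_map_in G w (t : {ffun 'I_d -> gT}) :
  t \in ffun_on G -> word_map w t \in G.
Proof.
move=> /ffun_onP tG; rewrite word_mapE; apply: group_prod => a _.
by rewrite /letter_val; case: a.2; rewrite ?groupV.
Qed.

Lemma word_map_conj w (t : 'I_d -> gT) (x : gT) :
  word_map w (fun i => (t i) ^ x)%g = ((word_map w t) ^ x)%g.
Proof.
apply: (@morph_word_map _ _ _ (fun y => (y ^ x)%g) _ _ predT) => //.
- by rewrite conj1g.
- by move=> y z _ _; rewrite conjMg.
- by move=> y _; rewrite conjVg.
Qed.

Definition word_count G w g : nat :=
  #|[set t : {ffun 'I_d -> gT} in ffun_on G | word_map w t == g]|.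

Lemma word_distE G w g :
  word_dist R G w g = (word_count G w g)%:R / #|G|%:R ^+ d.
Proof. by []. Qed.

Lemma word_dist_ge0 G w g : 0 <= word_dist R G w g.
Proof. by rewrite word_distE mulr_ge0 ?invr_ge0 ?exprn_ge0 ?ler0n. Qed.

Lemma natG_gt0 G : 0 < #|G|%:R :> R.
Proof. by rewrite ltr0n cardG_gt0. Qed.

Lemma sum_word_count G w (P : pred gT) :
  (\sum_(g in G | P g) word_count G w g =
   #|[set t : {ffun 'I_d -> gT} in ffun_on G | P (word_map w t)]|)%N.
Proof.
rewrite -sum1_card (partition_big (fun t : {ffun 'I_d -> gT} => word_map w t)
  (fun g => (g \in G) && P g)) => [|t]; last first.
  by rewrite inE => /andP[tG ->]; rewrite word_map_in.
apply: eq_bigr => g /andP[gG Pg]; rewrite /word_count -sum1_card.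
apply: eq_bigl => t; rewrite !inE; case: eqP => [->|]; last by rewrite !andbF.
by rewrite Pg !andbT.
Qed.

Lemma card_ffun_G G : #|[set t : {ffun 'I_d -> gT} in ffun_on G]| = (#|G| ^ d)%N.
Proof. by rewrite cardsE card_ffun_on card_ord. Qed.

Lemma sum_word_dist G w : \sum_(g in G) word_dist R G w g = 1.
Proof.
rewrite -mulr_suml -natr_sum.
have := sum_word_count G w predT; rewrite (eq_bigl (mem G)); last first.
  by move=> g; rewrite andbT.
move=> ->.
rewrite (_ : [set _ in _ | _] = [set t : {ffun 'I_d -> gT} in ffun_on G]).
  by rewrite card_ffun_G natrX divff // expf_neq0 // gt_eqF ?natG_gt0.
by apply/setP=> t; rewrite !inE andbT.
Qed.

(** Conjugating a whole tuple conjugates the value of the word. Since [x] need only normalize [G],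
    all of GL_2 acts on the distributions on SL_2. *)
Lemma word_dist_conj G w g x :
  x \in 'N(G)%g -> word_dist R G w (g ^ x)%g = word_dist R G w g.
Proof.
move=> nGx; rewrite !word_distE; congr (_%:R / _).
pose f (t : {ffun 'I_d -> gT}) : {ffun 'I_d -> gT} := [ffun i => t i ^ x]%g.
have f_inj : injective f.
  by move=> t1 t2 /ffunP e; apply/ffunP=> i; have := e i; rewrite !ffunE => /conjg_inj.
rewrite /word_count -[RHS](card_imset _ f_inj); apply: eq_card => t.
have wf (s : {ffun 'I_d -> gT}) : word_map w (f s) = (word_map w s ^ x)%g.
  by rewrite -word_map_conj !word_mapE; apply: eq_bigr => a _; rewrite /letter_val ffunE.
apply/idP/imsetP => [|[s + ->]]; rewrite inE => /andP[tG /eqP e].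
  exists [ffun i => t i ^ x^-1]%g; last by apply/ffunP=> i; rewrite !ffunE conjgKV.
  rewrite inE; apply/andP; split.
    by apply/ffun_onP=> i; rewrite ffunE memJ_norm ?groupV //; apply/ffun_onP.
  rewrite -(inj_eq (conjg_inj x)) -wf -e; apply/eqP; congr word_map.
  by congr fun_of_fin; apply/ffunP=> i; rewrite !ffunE conjgKV.
rewrite inE wf e eqxx andbT; apply/ffun_onP=> i.
by rewrite ffunE memJ_norm //; apply/ffun_onP.
Qed.

(** Exchanging the coordinates outside [X] between two tuples is an involution on pairs. It moves
    the condition on [v] from the first tuple to the second and keeps the condition on [u] on the
    first. *)
Lemma word_count_indep G u v (X : {set 'I_d}) x y :
  word_in X u -> word_in (~: X) v ->
  (#|[set t : {ffun 'I_d -> gT} in ffun_on G |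
      (word_map u t == x) && (word_map v t == y)]| * #|G| ^ d =
   word_count G u x * word_count G v y)%N.
Proof.
move=> uX vX.
pose mix (t s : {ffun 'I_d -> gT}) : {ffun 'I_d -> gT} :=
  [ffun i => if i \in X then t i else s i].
pose f (p : {ffun 'I_d -> gT} * {ffun 'I_d -> gT}) := (mix p.1 p.2, mix p.2 p.1).
have fK : involutive f.
  by case=> t s; rewrite /f /=; congr (_, _); apply/ffunP=> i; rewrite !ffunE; case: (i \in X).
have mixG t s : t \in ffun_on G -> s \in ffun_on G -> mix t s \in ffun_on G.
  by move=> /ffun_onP tG /ffun_onP sG; apply/ffun_onP=> i; rewrite ffunE; case: ifP.
have mu t s : word_map u (mix t s) = word_map u t.
  by apply: (eq_word_map uX) => i iX; rewrite ffunE iX.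
have mv t s : word_map v (mix t s) = word_map v s.
  by apply: (eq_word_map vX) => i; rewrite inE ffunE => /negPf->.
rewrite -card_ffun_G -!cardsX -(card_imset _ (can_inj fK)).
apply: eq_card => -[t s]; apply/imsetP/idP.
  case=> -[t' s']; rewrite !in_setX !in_set /= => /andP[/and3P[tG ux vy] sG] [-> ->].
  by rewrite /= !mixG // mu mv ux.
rewrite !in_setX !in_set /= => /andP[/andP[tG ux] /andP[sG vy]].
by exists (f (t, s)); rewrite ?fK // !in_setX !in_set /= !mixG // mu mv ux vy.
Qed.

(** The sum runs over the inverse of the value of [u], so that the two factors involve [x] and
    [x * g], the elements whose traces are studied jointly later. *)
Lemma word_dist_conv G u v (X : {set 'I_d}) g :
  word_in X u -> word_in (~: X) v -> g \in G ->
  word_dist R G (u * v)%g g =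
  \sum_(x in G) word_dist R G u (x^-1)%g * word_dist R G v (x * g)%g.
Proof.
move=> uX vX gG; rewrite word_distE.
have -> : word_count G (u * v)%g g = (\sum_(x in G)
   #|[set t : {ffun 'I_d -> gT} in ffun_on G |
      (word_map u t == x^-1)%g && (word_map v t == x * g)%g]|)%N.
  rewrite /word_count -sum1_card (partition_big
    (fun t : {ffun 'I_d -> gT} => (word_map u t)^-1%g) (mem G)) => [|t]; last first.
    by rewrite inE => /andP[tG _]; rewrite /= groupV word_map_in.
  apply: eq_bigr => x xG; rewrite -sum1_card; apply: eq_bigl => t; rewrite !inE.
  rewrite -andbA word_mapM; congr (_ && _).
  rewrite andbC -(inj_eq invg_inj) invgK; case: eqP => //= ->.
  by rewrite -(inj_eq (mulgI x)) mulKVg.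
rewrite natr_sum mulr_suml; apply: eq_bigr => x xG.
have G0 : #|G|%:R ^+ d != 0 :> R by rewrite expf_neq0 // gt_eqF ?natG_gt0.
rewrite !word_distE mulrACA -natrM -(word_count_indep _ _ _ uX vX) natrM natrX.
by rewrite [RHS]mulrA mulfK.
Qed.
End WordDist.

(** * Word distributions on quotient groups *)

Section WordDistQuotient.
Variables (R : realFieldType) (gT : finGroupType) (d : nat).
Variables (G H : {group gT}) (w : free_group d).
Hypothesis nHG : (H <| G)%g.

Lemma card_coset_fiber (y : coset_of H) :
  y \in (G / H)%g -> #|[set x in G | coset H x == y]| = #|H|.
Proof.
case/morphimP=> x Nx Gx ->{y}; rewrite -(card_rcoset H x).
have nGH := subsetP (normal_norm nHG).
apply: eq_card => y; rewrite inE; apply/andP/idP.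
  by case=> Gy /eqP; move/(rcoset_kercosetP (nGH _ Gy) Nx).
move=> yHx; have Gy : y \in G.
  by case/rcosetP: yHx => h Hh ->; rewrite groupM // (subsetP (normal_sub nHG)).
by split=> //; apply/eqP/(rcoset_kercosetP (nGH _ Gy) Nx).
Qed.

(** Tuples reduce coordinatewise modulo [H], and each tuple over the quotient has [#|H| ^ d]
    lifts. *)
Lemma sum_word_count_coset g : g \in G ->
  (\sum_(z in H) word_count G w (g * z)%g =
   #|H| ^ d * word_count (G / H)%G w (coset H g))%N.
Proof.
move=> Gg; have nGH := subsetP (normal_norm nHG).
have sHG := subsetP (normal_sub nHG).
pose pi (t : {ffun 'I_d -> gT}) : {ffun 'I_d -> coset_of H} :=
  [ffun i => coset H (t i)].
have pi_word t : t \in ffun_on G ->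
    word_map w (pi t) = coset H (word_map w t).
  move=> /ffun_onP tG; rewrite -(@morph_word_map _ _ _ (coset H) w t (mem 'N(H)%g)).
  - by rewrite !word_mapE; apply: eq_bigr => a _; rewrite /letter_val ffunE.
  - by rewrite /= group1.
  - by move=> x y; apply: groupM.
  - by move=> x /=; rewrite groupV.
  - by rewrite morph1.
  - by move=> x y; apply: morphM.
  - by move=> x; apply: morphV.
  by move=> i; apply/nGH/tG.
have -> : (\sum_(z in H) word_count G w (g * z)%g =
   #|[set t : {ffun 'I_d -> gT} in ffun_on G |
       coset H (word_map w t) == coset H g]|)%N.
  rewrite -(sum_word_count G w (fun x => coset H x == coset H g)).
  rewrite (reindex_onto (fun x => g^-1 * x)%g (fun z => g * z)%g) /=; last first.
    by move=> z _; rewrite mulKg.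
  apply: eq_big => [x|x _]; last by rewrite mulKVg.
  rewrite mulKVg eqxx andbT; apply/idP/andP.
    move=> Hx; have Gx : x \in G by rewrite -(mulKVg g x) groupM // sHG.
    split=> //; apply/eqP; rewrite -(mulKVg g x) morphM /=; [|exact: nGH..|].
      by rewrite (coset_id Hx) mulg1.
    by apply: nGH; rewrite groupM ?groupV.
  case=> Gx /eqP e; apply: coset_idr; first by apply: nGH; rewrite groupM ?groupV.
  rewrite morphM /= ?morphV /= ?e ?mulVg //; try exact: nGH.
  by apply: nGH; rewrite groupV.
rewrite -sum1_card (partition_big pi
   (mem [set t : {ffun 'I_d -> coset_of H} in ffun_on (G / H)%g |
          word_map w t == coset H g])) => [|t]; last first.
  rewrite in_set => /andP[tG /eqP e]; rewrite /= in_set pi_word // e eqxx andbT.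
  apply/ffun_onP=> i; rewrite ffunE; apply: mem_quotient.
  by move/ffun_onP: tG; apply.
rewrite /word_count -[X in (_ = _ * X)%N]sum1_card big_distrr /=; apply: eq_bigr => s.
rewrite in_set => /andP[/ffun_onP sG /eqP ws]; rewrite muln1 sum1_card.
rewrite (eq_card (B := family (fun i => mem [set x in G | coset H x == s i]))).
  rewrite card_family /image_mem (eq_map (g := fun=> #|H|)) => [|i]; last first.
    exact: card_coset_fiber.
  by rewrite -[in RHS](size_enum_ord d); elim: (enum _) => //= _ e ->; rewrite expnS.
move=> t; rewrite [LHS]unfold_in; apply/andP/familyP.
  case=> /[!in_set]/andP[/ffun_onP tG _] /eqP <- i.
  by rewrite inE tG /pi ffunE eqxx.
move=> tF; have tG : t \in ffun_on G.
  by apply/ffun_onP=> i; have := tF i; rewrite inE => /andP[].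
have pit : pi t = s.
  by apply/ffunP=> i; have := tF i; rewrite inE ffunE => /andP[_ /eqP].
by rewrite in_set tG -pi_word // pit ws !eqxx.
Qed.

Lemma word_dist_quotient g : g \in G ->
  word_dist R (G / H)%G w (coset H g) = \sum_(z in H) word_dist R G w (g * z)%g.
Proof.
move=> Gg; rewrite -mulr_suml -natr_sum sum_word_count_coset // word_distE.
have H0 : #|H|%:R ^+ d != 0 :> R by rewrite expf_neq0 // gt_eqF ?natG_gt0.
rewrite -(LagrangeI G H) (setIidPr (normal_sub nHG)) -card_quotient ?normal_norm //.
by rewrite !natrM exprMn natrX -mulf_div divff // mul1r.
Qed.

(** The density on the quotient is the mean of the density on [G] over a coset of [H], so its
    deviation from 1 is no larger. *)
Lemma Linfty_word_dist_quotient (B : R) : 0 <= B ->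
  (forall g, g \in G -> `|#|G|%:R * word_dist R G w g - 1| <= B) ->
  Linfty_norm (G / H)%G
    (fun g => word_dist R (G / H)%G w g - unif_dist R (G / H)%G g) <= B.
Proof.
move=> B0 GB; rewrite /Linfty_norm mulrC -ler_pdivlMr ?natG_gt0 //.
apply: bigmax_le => [|y]; first by rewrite divr_ge0.
case/morphimP=> g Ng Gg ->; rewrite /unif_dist mem_quotient //.
rewrite word_dist_quotient // ler_pdivlMr ?natG_gt0 // mulrC.
have GH : #|G|%:R = #|H|%:R * #|(G / H)%G|%:R :> R.
  by rewrite -(LagrangeI G H) (setIidPr (normal_sub nHG)) -card_quotient
    ?normal_norm // natrM.
have H0 : #|H|%:R != 0 :> R by rewrite gt_eqF ?natG_gt0.
have Q0 : #|(G / H)%G|%:R != 0 :> R by rewrite gt_eqF ?natG_gt0.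
rewrite -{1}(ger0_norm (ler0n R #|(G / H)%G|)) -normrM mulrBr mulfV //.
have -> : #|(G / H)%G|%:R * (\sum_(z in H) word_dist R G w (g * z)%g) - 1 =
  #|H|%:R^-1 * \sum_(z in H) (#|G|%:R * word_dist R G w (g * z)%g - 1).
  rewrite sumrB sumr_const -mulr_sumr GH mulrBr mulVf //.
  by rewrite !mulrA mulVf // mul1r.
rewrite normrM ger0_norm ?invr_ge0 ?ler0n // mulrC ler_pdivrMr ?natG_gt0 //.
rewrite (le_trans (ler_norm_sum _ _ _)) // mulr_natr -[leRHS]sumr_const.
apply: ler_sum => z Hz; apply: GB.
by rewrite groupM // (subsetP (normal_sub nHG)).
Qed.

End WordDistQuotient.

(** * Cyclic reduction and traces of products of unipotents *)

Section CyclicReduction.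
Variable d : nat.
Implicit Types (s : seq (letter d)).

Definition cyc_reduced s := path.cycle (fun a b : letter d => b != linv a) s.

(** While the first and last letters are mutually inverse, both are stripped, which conjugates the
    value. Reducedness keeps the process from ending in the empty word. *)
Lemma cyc_reduction s : reduced s -> s != [::] ->
  exists s', [/\ s' != [::], (size s' <= size s)%N, cyc_reduced s' &
    forall (gT : groupType) (t : 'I_d -> gT),
      exists g, seq_val t s = (g * seq_val t s' * g^-1)%g].
Proof.
have [n] := ubnP (size s); elim: n s => // n IHn [|a s] //= sn rs _.
have triv s1 : s1 != [::] -> cyc_reduced s1 -> exists s', [/\ s' != [::],
    (size s' <= size s1)%N, cyc_reduced s' & forall (gT : groupType) t,
    exists g : gT, seq_val t s1 = (g * seq_val t s' * g^-1)%g].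
  by move=> s0 cs; exists s1; split=> // gT t; exists 1%g; rewrite mul1g invg1 mulg1.
case/lastP: s => [|m b] in sn rs *.
  apply: (triv [:: a]) => //; rewrite /cyc_reduced /= andbT.
  by case: (a) => i []; rewrite xpair_eqE andbF.
have [ab|ab] := eqVneq a (linv b); last first.
  apply: (triv (a :: rcons m b)) => //.
  rewrite /cyc_reduced /= rcons_path last_rcons ab andbT.
  exact: rs.
rewrite ab in rs *.
have rm : reduced m.
  move: rs; rewrite /reduced /= rcons_path => /andP[pm _].
  by move: pm; case: (m) => //= c m' /andP[].
have m0 : m != [::] by apply: contraTneq rs => -> /=; rewrite linvK eqxx.
have smn : (size m < n)%N by move: sn; rewrite size_rcons ltnS; apply: ltn_trans.
have [s' [s'0 szs' cs' s'E]] := IHn m smn rm m0.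
exists s'; split=> //.
  by rewrite size_rcons (leq_trans szs') // -addn2 leq_addr.
move=> gT t; have [g mE] := s'E gT t.
exists (letter_val t (linv b) * g)%g.
rewrite seq_val_cons -cats1 /seq_val big_cat big_seq1 /= -/(seq_val t m) mE.
by rewrite letter_val_linv invMg invgK !mulgA.
Qed.

(** When [a0] is the head of the word, these are its cyclically consecutive pairs of letters. *)
Fixpoint cyc_pairs (a0 : letter d) s :=
  if s is a :: s' then (a, head a0 s') :: cyc_pairs a0 s' else [::].

Lemma size_cyc_pairs a0 s : size (cyc_pairs a0 s) = size s.
Proof. by elim: s => //= a s ->. Qed.

Lemma all_cyc_pairs (e : rel (letter d)) a0 a s :
  all (fun p => e p.1 p.2) (cyc_pairs a0 (a :: s)) = path e a (rcons s a0).
Proof. by elim: s a => [|b s IHs] a //=; rewrite -IHs. Qed.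

End CyclicReduction.

(** * Two by two matrices and the trace polynomial of a product of unipotents *)

Section Matrix2.
Variable R : comNzRingType.
Implicit Types A B : 'M[R]_2.

Lemma sum_ord2 (V : nmodType) (f : 'I_2 -> V) : \sum_(i < 2) f i = f 0 + f 1.
Proof.
rewrite !big_ord_recl big_ord0 addr0; congr (f _ + f _); exact: val_inj.
Qed.

Lemma ord2P (P : 'I_2 -> Prop) : P 0 -> P 1 -> forall i, P i.
Proof.
move=> P0 P1 i; have [->|->] // : i = 0 \/ i = 1.
by case: i => -[|[|//]] ?; [left|right]; apply: val_inj.
Qed.

Lemma mx2P A B : A 0 0 = B 0 0 -> A 0 1 = B 0 1 -> A 1 0 = B 1 0 ->
  A 1 1 = B 1 1 -> A = B.
Proof. by move=> *; apply/matrixP; apply: ord2P; apply: ord2P. Qed.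

Lemma mulmx2E A B i j : (A *m B) i j = A i 0 * B 0 j + A i 1 * B 1 j.
Proof. by rewrite mxE sum_ord2. Qed.

Lemma mxtrace2 A : \tr A = A 0 0 + A 1 1.
Proof. by rewrite /mxtrace sum_ord2. Qed.

Lemma det_mx2 A : \det A = A 0 0 * A 1 1 - A 0 1 * A 1 0.
Proof.
rewrite (expand_det_row A 0) sum_ord2 /cofactor !det_mx11 !mxE /=.
have l0 : lift (0 : 'I_2) (0 : 'I_1) = 1 by apply/eqP.
have l1 : lift (1 : 'I_2) (0 : 'I_1) = 0 by apply/eqP.
by rewrite l0 l1 /= addn0 expr0 expr1 mul1r mulN1r mulrN.
Qed.

Definition mx2 (a b c d : R) : 'M[R]_2 :=
  \matrix_(i, j) if i == 0 then if j == 0 then a else b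
                 else if j == 0 then c else d.

Lemma mx2E a b c d : (mx2 a b c d 0 0 = a) * (mx2 a b c d 0 1 = b) *
  (mx2 a b c d 1 0 = c) * (mx2 a b c d 1 1 = d).
Proof. by rewrite !mxE. Qed.

End Matrix2.

Section TracePoly.
Variable F : fieldType.
Implicit Types (e x : F) (M : 'M[F]_2).

Definition unip_step (p : F * 'M[F]_2) : 'M[{poly F}]_2 :=
  mx2 1 (p.1 *: 'X) 0 1 *m map_mx polyC p.2.

Definition unip_prod (l : seq (F * 'M[F]_2)) : 'M[{poly F}]_2 :=
  foldr (fun p => mulmx (unip_step p)) 1%:M l.

Lemma unip_prod_eval x l :
  map_mx (horner_eval x) (unip_prod l) =
  foldr (fun p => mulmx (mx2 1 (p.1 * x) 0 1 *m p.2)) 1%:M l.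
Proof.
elim: l => [|p l IHl] /=; first by rewrite map_mx1.
rewrite !map_mxM IHl; congr (_ *m _ *m _).
  by apply: mx2P; rewrite !mxE /= /horner_eval ?hornerE.
by apply/matrixP=> i j; rewrite !mxE; apply: hornerC.
Qed.

(** Each step raises the degree only in the top row, through [p.1 *: 'X] times the bottom row of
    [p.2 *m Q]; the leading coefficient of [Q 0 0] is thus the product of the [p.1 * p.2 1 0]. The
    bound on [Q 1 1] keeps it from cancelling this term in the trace; [maxn] covers the empty
    product. *)
Lemma size_unip_prod l :
  all (fun p : F * 'M[F]_2 => (p.1 != 0) && (p.2 1 0 != 0)) l ->
  let Q := unip_prod l in
  [/\ size (Q 0 0) = (size l).+1, (size (Q 1 0)%R <= size l)%N,
      (size (Q 0 1)%R <= (size l).+1)%N & (size (Q 1 1)%R <= maxn (size l) 1)%N].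
Proof.
elim: l => [_|[e M] l IHl /= /andP[/andP[/= e0 M0] /IHl]] /=.
  by rewrite !mxE /= size_poly1 size_poly0.
set Q := unip_prod l; set n := size l; move=> [Q00 Q10 Q01 Q11].
pose T := map_mx polyC M *m Q.
have TE i j : T i j = (M i 0)%:P * Q 0 j + (M i 1)%:P * Q 1 j.
  by rewrite mulmx2E !mxE.
have leC c (p : {poly F}) m : (size p <= m)%N -> (size (c%:P * p)%R <= m)%N.
  have [->|c0] := eqVneq c 0; first by rewrite mul0r size_poly0.
  by rewrite size_Cmul.
have leD (p q : {poly F}) m : (size p <= m)%N -> (size q <= m)%N ->
    (size (p + q)%R <= m)%N.
  by move=> pm qm; rewrite (leq_trans (size_polyD _ _)) // geq_max pm.
have T10 : size (T 1 0) = n.+1.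
  have sM : size ((M 1 0)%:P * Q 0 0) = n.+1 by rewrite size_Cmul.
  by rewrite TE size_polyDl sM // ltnS leC.
have T00 : (size (T 0 0)%R <= n.+1)%N by rewrite TE leD ?leC ?Q00 // leqW.
have Q11' : (size (Q 1 1)%R <= n.+1)%N.
  by rewrite (leq_trans Q11) // geq_max leqnSn.
have T11 : (size (T 1 1)%R <= n.+1)%N by rewrite TE leD ?leC.
have T01 : (size (T 0 1)%R <= n.+1)%N by rewrite TE leD ?leC.
have sX p : p != 0 -> size ((e *: 'X) * p) = (size p).+1.
  by move=> p0; rewrite -scalerAl size_scale // mulrC size_mulX.
rewrite /unip_step -mulmxA -/T; move: (T) T10 T00 T11 T01 => {TE}{}T T10 T00 T11 T01.
rewrite !mulmx2E !mx2E !mul1r !mul0r !add0r.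
have T10n0 : T 1 0 != 0 by rewrite -size_poly_gt0 T10.
split=> //.
- have sT : size (e *: 'X * T 1 0) = n.+2 by rewrite sX // T10.
  by rewrite addrC size_polyDl sT // ltnS.
- by rewrite T10.
- rewrite leD // ?(leqW T01) //; have [->|T0] := eqVneq (T 1 1) 0.
    by rewrite mulr0 size_poly0.
  by rewrite sX.
Qed.

Lemma size_trace_unip_prod l : l != [::] ->
  all (fun p : F * 'M[F]_2 => (p.1 != 0) && (p.2 1 0 != 0)) l ->
  size (\tr (unip_prod l)) = (size l).+1.
Proof.
move=> l0 /size_unip_prod[Q00 _ _ Q11].
rewrite mxtrace2 size_polyDl Q00 //; apply: leq_ltn_trans Q11 _.
by rewrite gtn_max ltnSn ltnS lt0n size_eq0.
Qed.

End TracePoly.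

Lemma trace_unip_prod_roots (F : finFieldType) (l : seq (F * 'M[F]_2)) (c : F) :
  l != [::] -> all (fun p : F * 'M[F]_2 => (p.1 != 0) && (p.2 1 0 != 0)) l ->
  (#|[set x : F | \tr (foldr (fun p => mulmx (mx2 1 (p.1 * x) 0 1 *m p.2)) 1%:M l)
      == c]%R| <= size l)%N.
Proof.
move=> l0 gl; set S := [set _ | _].
have szT := size_trace_unip_prod l0 gl.
pose P := \tr (unip_prod l) - c%:P.
have szP : size P = (size l).+1.
  rewrite size_polyDl ?szT // size_polyN (leq_ltn_trans (size_polyC_leq1 _)) //.
  by rewrite ltnS lt0n size_eq0.
rewrite cardE -ltnS -szP; apply: max_poly_roots.
- by rewrite -size_poly_eq0 szP.
- apply/allP=> x; rewrite mem_enum inE -unip_prod_eval => /eqP xc.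
  rewrite rootE /P hornerD hornerN hornerC subr_eq0 -xc.
  by rewrite mxtrace2 hornerD [in X in _ == X]mxtrace2 !mxE.
exact: enum_uniq.
Qed.

(** * Word traces on SL2 *)

Section SL2Elements.
Variable F : finFieldType.
Implicit Types (g h : {'GL_2[F]}) (M : 'M[F]_2).

(** Singular matrices are sent to the identity. *)
Definition gl_of M : {'GL_2[F]} := insubd (1%g : {'GL_2[F]}) M.

Lemma gl_ofE M : \det M != 0 -> GLval (gl_of M) = M.
Proof. by move=> dM; apply: insubdK; rewrite -topredE /= unitmxE unitfE. Qed.

Lemma SL2P g : reflect (\det (GLval g) = 1) (g \in SL2 F).
Proof. by rewrite inE; apply: eqP. Qed.

Lemma gl_of_SL2 M : \det M = 1 -> (GLval (gl_of M) = M) * (gl_of M \in SL2 F).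
Proof.
move=> dM; have gM : GLval (gl_of M) = M by rewrite gl_ofE // dM oner_neq0.
by split=> //; apply/SL2P; rewrite gM.
Qed.

Lemma GLval_inj : injective (@GLval 2 F).
Proof. exact: val_inj. Qed.

Lemma SL2_invE g : g \in SL2 F ->
  GLval g^-1%g = mx2 (GLval g 1 1) (- GLval g 0 1) (- GLval g 1 0) (GLval g 0 0).
Proof.
move=> /SL2P; rewrite det_mx2 => dg.
set X := mx2 _ _ _ _.
have gX : GLval g *m X = 1%:M.
  apply: mx2P; rewrite mulmx2E !mx2E [RHS]mxE //=; first by rewrite -dg; ring.
  - by ring.
  - by ring.
  by rewrite -dg; ring.
by rewrite GL_VxE -[LHS]mulmx1 -gX mulmxA (mulVmx (GL_unitmx g)) mul1mx.
Qed.

Lemma SL2M g h : g \in SL2 F -> h \in SL2 F -> (g * h)%g \in SL2 F.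
Proof. by move=> /SL2P dg /SL2P dh; apply/SL2P; rewrite det_mulmx dg dh mulr1. Qed.

Lemma SL2V g : g \in SL2 F -> (g^-1)%g \in SL2 F.
Proof. by move=> /SL2P dg; apply/SL2P; rewrite det_inv dg invr1. Qed.

Definition upper x : {'GL_2[F]} := gl_of (mx2 1 x 0 1).
Definition lower x : {'GL_2[F]} := gl_of (mx2 1 0 x 1).

Lemma upper_SL2 x : (GLval (upper x) = mx2 1 x 0 1) * (upper x \in SL2 F).
Proof. by apply: gl_of_SL2; rewrite det_mx2 !mx2E; ring. Qed.

Lemma lower_SL2 x : (GLval (lower x) = mx2 1 0 x 1) * (lower x \in SL2 F).
Proof. by apply: gl_of_SL2; rewrite det_mx2 !mx2E; ring. Qed.

Lemma upperV x : ((upper x)^-1 = upper (- x))%g.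
Proof.
apply: GLval_inj; rewrite SL2_invE ?upper_SL2 //.
by congr mx2; rewrite !mx2E ?oppr0.
Qed.

End SL2Elements.

(** * A fixed trace has probability O(1/q) *)

Section TraceBound.
Variables (F : finFieldType) (d : nat).
Notation gT := {'GL_2[F]}.
Notation S := (SL2 F).
Implicit Types (h : {ffun letter d -> gT}) (a b : letter d) (s : seq (letter d)).

(* A uniform x in F and a uniform h : letters -> SL2 give a uniform tuple t,   *)
(* along which a letter l takes the value h(l) upper(+/-x) h(l^-1)^-1.         *)
Definition twist h (x : F) : {ffun 'I_d -> gT} :=
  [ffun i => h (i, false) * upper x * (h (i, true))^-1]%g.

Definition letter_sign a : F := if a.2 then -1 else 1.

Lemma letter_val_twist h x a : letter_val (twist h x) a =
  (h a * upper (letter_sign a * x) * (h (linv a))^-1)%g.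
Proof.
case: a => i []; rewrite /letter_val /letter_sign /linv /= ffunE ?mul1r //.
by rewrite !invMg upperV invgK mulN1r mulgA.
Qed.

Definition twist_steps h a0 s : seq (F * 'M[F]_2) :=
  [seq (letter_sign p.1, GLval ((h (linv p.1))^-1 * h p.2)%g) | p <- cyc_pairs a0 s].

(** Between consecutive letters a and b the factors [h (linv a)] inverse and [h b] merge into one
    matrix. The extra [h a0] closes the last gap, so that for [a0] the head of the word the product
    of steps is conjugate to its value. *)
Lemma seq_val_twist h x a0 s :
  GLval (seq_val (twist h x) s * h a0)%g = GLval (h (head a0 s)) *m
  foldr (fun p => mulmx (mx2 1 (p.1 * x) 0 1 *m p.2)) 1%:M (twist_steps h a0 s).
Proof.
elim: s => [|a s IHs].
  have -> : seq_val (twist h x) [::] = 1%g by rewrite /seq_val big_nil.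
  by rewrite mul1g mulmx1.
rewrite [foldr _ _ _]/= -/(twist_steps h a0 s) [head _ (a :: s)]/=.
rewrite seq_val_cons -mulgA GL_ME IHs letter_val_twist !GL_MxE upper_SL2.
by rewrite -!mulmxE !mulmxA.
Qed.

Lemma trace_seq_val_twist h x a s :
  \tr (GLval (seq_val (twist h x) (a :: s))) =
  \tr (foldr (fun p => mulmx (mx2 1 (p.1 * x) 0 1 *m p.2)) 1%:M
         (twist_steps h a (a :: s))).
Proof.
have := seq_val_twist h x a (a :: s); set P := foldr _ _ _ => E.
rewrite -(mulgK (h a) (seq_val _ _)) GL_MxE E mxtrace_mulC mulmxA.
by rewrite -GL_MxE mulVg GL_1E mul1mx.
Qed.

Definition bad_pair (p : letter d * letter d) : {set {ffun letter d -> gT}} :=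
  [set h in ffun_on S | GLval ((h (linv p.1))^-1 * h p.2)%g 1 0 == 0].

Lemma card_letters_ffun :
  #|[set h : {ffun letter d -> gT} in ffun_on S]| = (#|S| ^ (d + d))%N.
Proof.
by rewrite cardsE card_ffun_on card_prod card_ord card_bool muln2 addnn.
Qed.

(** As [b] and [linv a] are distinct, [h b] can be varied independently of [h (linv a)]. Left
    multiplication by [lower y] adds [y * M 0 0] to the lower left entry of the merged matrix M, and
    [M 0 0] is nonzero when that entry vanishes; so the q modifications of bad assignments are all
    distinct. *)
Lemma card_bad_pair a b : b != linv a ->
  (#|F| * #|bad_pair (a, b)| <= #|S| ^ (d + d))%N.
Proof.
move=> ba; set c := linv a.
pose f (p : F * {ffun letter d -> gT}) : {ffun letter d -> gT} :=
  [ffun l => if l == b then (p.2 c * lower p.1 * (p.2 c)^-1 * p.2 b)%g else p.2 l].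
have fc p : f p c = p.2 c by rewrite ffunE eq_sym (negPf ba).
have fb p : ((f p c)^-1 * f p b = lower p.1 * ((p.2 c)^-1 * p.2 b))%g.
  by rewrite fc ffunE eqxx !mulgA mulVg mul1g.
rewrite -card_letters_ffun -cardsT -cardsX -(card_in_imset (f := f)).
  apply/subset_leq_card/subsetP=> _ /imsetP[[y h] /setXP[_ /[!in_set]/andP[hS _]] ->].
  apply/ffun_onP=> l; rewrite ffunE; move/ffun_onP: hS => hS.
  case: ifP => _; last exact: hS.
  apply: SL2M (hS b); apply: SL2M (SL2V (hS c)).
  exact: SL2M (hS c) (lower_SL2 _).2.
case=> y h [y' h'] /setXP[_ hB] /setXP[_ hB'] eqf.
have hc : h c = h' c by rewrite -[LHS](fc (y, h)) eqf fc.
have := fb (y, h); rewrite eqf fb /=; set M' := (_^-1 * _)%g; set M := (_^-1 * _)%g.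
move=> eM; move: hB hB'; rewrite !in_set -/c -/M -/M' => /andP[/ffun_onP hS /eqP M10].
move=> /andP[/ffun_onP h'S /eqP M'10].
have M'S : M' \in S by apply: SL2M => //; apply: SL2V.
have low10 z (A : gT) : GLval A 1 0 = 0 ->
    GLval (lower z * A)%g 1 0 = z * GLval A 0 0.
  by move=> A0; rewrite GL_MxE lower_SL2 mulmx2E !mx2E A0; ring.
have low00 z (A : gT) : GLval (lower z * A)%g 0 0 = GLval A 0 0.
  by rewrite GL_MxE lower_SL2 mulmx2E !mx2E; ring.
have e10 : y * GLval M 0 0 = y' * GLval M' 0 0.
  by rewrite -(low10 _ _ M10) -(low10 _ _ M'10) -eM.
have e00 : GLval M' 0 0 = GLval M 0 0.
  by rewrite -(low00 y') eM low00.
have M'0 : GLval M' 0 0 != 0.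
  apply/eqP=> z; have /SL2P := M'S.
  by rewrite det_mx2 z M'10 !(mul0r, mulr0) subrr => /esym/eqP; rewrite oner_eq0.
have yy : y = y' by apply: (mulIf M'0); rewrite -e10 e00.
congr (_, _) => //; apply/ffunP=> l; have [->|lb] := eqVneq l b.
  by move: eM; rewrite yy => /mulgI; rewrite /M /M' hc => /mulgI.
by move/ffunP: eqf => /(_ l); rewrite !ffunE (negPf lb).
Qed.

(** The factor 2 adds two contributions of the word length: one from the assignments [h] killing the
    leading coefficient, one from the roots x of the trace polynomial for the other [h]. *)
Lemma card_trace_seq_val a s (c : F) : cyc_reduced (a :: s) ->
  (#|F| * #|[set t : {ffun 'I_d -> gT} in ffun_on S |
     \tr (GLval (seq_val t (a :: s))) == c]| <= 2 * (size s).+1 * #|S| ^ d)%N.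
Proof.
move=> cs; set T := [set t in _ | _].
pose n := (size s).+1.
pose X := [set p : {ffun letter d -> gT} * F | (p.1 \in ffun_on S) &&
  (\tr (GLval (seq_val (twist p.1 p.2) (a :: s))) == c)].
have leX : (#|F| * #|T| * #|S| ^ d <= #|X|)%N.
  (* For given x and t, the values h(i, true) are free and then t determines h(i, false), so
     twisting covers each t at least [#|S| ^ d] times for each x. *)
  pose f (p : F * {ffun 'I_d -> gT} * {ffun 'I_d -> gT}) :
      {ffun letter d -> gT} * F :=
    ([ffun l => if l.2 then p.2 l.1 else (p.1.2 l.1 * p.2 l.1 * (upper p.1.1)^-1)%g],
     p.1.1).
  have ftw p : twist (f p).1 (f p).2 = p.1.2.
    by apply/ffunP=> i; rewrite !ffunE mulgKV mulgK.
  have f_inj : injective f.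
    move=> p p' eqf; have := ftw p; rewrite eqf ftw.
    case: eqf => /ffunP e; case: p p' e => [[x t] k] [[x' t'] k'] /= e -> ->.
    by congr (_, _); apply/ffunP=> i; have := e (i, true); rewrite !ffunE.
  rewrite -(card_ffun_G d S) -cardsT -!cardsX -(card_imset _ f_inj).
  apply/subset_leq_card/subsetP=> _ /imsetP[[[x t] k] + ->].
  rewrite !in_setX !in_set => /andP[/andP[_ /andP[/ffun_onP tS tc]] /ffun_onP kS].
  apply/andP; split; last by have := ftw (x, t, k) => /= ->.
  apply/ffun_onP=> l; rewrite ffunE /=; case: l.2 => //.
  exact: SL2M (SL2M (tS _) (kS _)) (SL2V (upper_SL2 _).2).
pose bad := \bigcup_(p <- cyc_pairs a (a :: s)) bad_pair p.
have bad_le : (#|F| * #|bad| <= n * #|S| ^ (d + d))%N.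
  rewrite /bad -[n]/(size (a :: s)) -(size_cyc_pairs a (a :: s)).
  have : all (fun p => p.2 != linv p.1) (cyc_pairs a (a :: s)).
    by rewrite (all_cyc_pairs (fun a b => b != linv a)).
  elim: (cyc_pairs _ _) => [_|[u v] l IHl /andP[/= uv /IHl lel]].
    by rewrite big_nil cards0 muln0.
  rewrite big_cons (leq_trans (leq_mul (leqnn _) (leq_card_setU _ _))) //.
  by rewrite mulnDr mulSn leq_add // card_bad_pair.
have Xle : (#|X| <= #|F| * #|bad| + n * #|S| ^ (d + d))%N.
  have -> : #|X| = (\sum_(h in [set h : {ffun letter d -> gT} in ffun_on S])
    #|[set x : F | \tr (GLval (seq_val (twist h x) (a :: s))) == c]|)%N.
    rewrite -sum1_card (eq_bigr (fun h => \sum_(x : F |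
      \tr (GLval (seq_val (twist h x) (a :: s))) == c) 1))%N => [|h _]; last first.
      by rewrite -sum1_card; apply: eq_bigl => x; rewrite in_set.
    rewrite (pair_big_dep _ _ (fun h (x : F) => 1))%N; apply: eq_bigl => -[h x].
    by rewrite !in_set.
  rewrite -card_letters_ffun (bigID (mem bad)) /= leq_add //.
    rewrite mulnC -sum_nat_const big_mkcond [leqRHS]big_mkcond /=.
    by apply: leq_sum => h _; case: ifP => // /andP[_ ->]; apply: max_card.
  rewrite mulnC -sum_nat_const big_mkcondr /=; apply: leq_sum => h hS.
  case: ifP => // hbad; have -> : n = size (twist_steps h a (a :: s)).
    by rewrite size_map size_cyc_pairs.
  under eq_finset => x do rewrite trace_seq_val_twist.
  apply: trace_unip_prod_roots => //.
  rewrite all_map; apply/allP=> p pin /=; apply/andP; split.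
    by rewrite /letter_sign; case: p.1.2; rewrite ?oppr_eq0 oner_eq0.
  apply: contraNN hbad => p0; rewrite /bad (big_rem p pin) inE /= inE p0 andbT.
  by rewrite in_set in hS; rewrite hS.
have S0 : (0 < #|S| ^ d)%N by rewrite expn_gt0 cardG_gt0.
rewrite -(leq_pmul2r S0) (leq_trans leX) // (leq_trans Xle) //.
by rewrite -mulnA -expnD mul2n -addnn mulnDl leq_add2r.
Qed.

Lemma card_trace_word (w : free_group d) (c : F) : w <> 1%g ->
  (#|F| * #|[set t : {ffun 'I_d -> gT} in ffun_on S |
     \tr (GLval (word_map w t)) == c]| <= 2 * size (letters w) * #|S| ^ d)%N.
Proof.
move=> w1; have w0 : letters w != [::].
  by apply: contra_notN w1 => /eqP w0; apply: val_inj.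
have [s' [s'0 szs cs sE]] := cyc_reduction (valP w) w0.
case: s' => [|a s] // in s'0 szs cs sE *.
apply: (@leq_trans (2 * (size s).+1 * #|S| ^ d)); last first.
  by rewrite leq_mul2r leq_mul2l szs !orbT.
rewrite (leq_trans _ (card_trace_seq_val c cs)) // leq_mul2l; apply/orP; right.
apply/subset_leq_card/subsetP=> t; rewrite !in_set => /andP[-> /eqP <-] /=.
have [g] := sE _ (t : 'I_d -> gT); rewrite word_mapE => ->.
rewrite !GL_MxE mxtrace_mulC mulmxA -GL_MxE mulVg GL_1E mul1mx.
exact: eqxx.
Qed.

End TraceBound.

(** * Equidistribution of pairs of traces *)

Section TracePairs.
Variables (F : finFieldType) (s : F).
Notation q := #|F|.
Implicit Types (p z : F * F).

Definition companion : {'GL_2[F]} := gl_of (mx2 0 (-1) 1 s).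

Lemma companion_SL2 : (GLval companion = mx2 0 (-1) 1 s) * (companion \in SL2 F).
Proof. by apply: gl_of_SL2; rewrite det_mx2 !mx2E; ring. Qed.

(* x in SL2 is determined by p = (tr x, tr (x * companion)) and its second     *)
(* column z; its determinant is 1 exactly when incident p z.                   *)
Definition qform z : F := z.1 ^+ 2 + s * z.1 * z.2 + z.2 ^+ 2.
Definition incident p z : bool := p.2 * z.1 + p.1 * z.2 == qform z + 1.
Definition trace_pair_count p : nat := #|[set z | incident p z]|.

Lemma sum_SL2_trace_pair (V : nmodType) (f : F * F -> V) :
  \sum_(x in SL2 F) f (\tr (GLval x), \tr (GLval (x * companion)%g)) =
  \sum_p f p *+ trace_pair_count p.
Proof.
(* Solves for the first column of x from its two traces and its second column. *)
pose mk (pz : (F * F) * (F * F)) : {'GL_2[F]} :=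
  gl_of (mx2 (pz.1.1 - pz.2.2) pz.2.1 (pz.2.1 + s * pz.2.2 - pz.1.2) pz.2.2).
pose tp (x : {'GL_2[F]}) := (\tr (GLval x), \tr (GLval (x * companion)%g)).
pose co (x : {'GL_2[F]}) := (tp x, (GLval x 0 1, GLval x 1 1)).
have tpE x : tp x = (GLval x 0 0 + GLval x 1 1,
                     GLval x 0 1 - GLval x 1 0 + s * GLval x 1 1).
  rewrite /tp GL_MxE companion_SL2 !mxtrace2 !mulmx2E !mx2E.
  by congr (_, _); ring.
have co_inc x : x \in SL2 F -> incident (co x).1 (co x).2.
  move=> /SL2P; rewrite det_mx2 => dx; rewrite /incident /co tpE /= -dx /qform /=.
  by apply/eqP; ring.
have mkE p z : incident p z -> GLval (mk (p, z)) =
    mx2 (p.1 - z.2) z.1 (z.1 + s * z.2 - p.2) z.2 /\ mk (p, z) \in SL2 F.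
  move=> /eqP pz; suff /gl_of_SL2[-> ->] : \det (mx2 (p.1 - z.2) z.1
      (z.1 + s * z.2 - p.2) z.2) = 1 by [].
  rewrite det_mx2 !mx2E.
  transitivity (p.2 * z.1 + p.1 * z.2 - qform z); first by rewrite /qform; ring.
  by rewrite pz; ring.
have mkK p z : incident p z -> co (mk (p, z)) = (p, z).
  move=> /mkE[E _]; rewrite /co tpE E !mx2E; case: (p) (z) => a c [u v] /=.
  by congr (_, _, _); ring.
have coK x : x \in SL2 F -> mk (co x) = x.
  move=> /co_inc /mkE[E _]; apply: GLval_inj; rewrite E /co tpE /=.
  by apply: mx2P; rewrite mx2E //=; ring.
transitivity (\sum_p \sum_(z | incident p z) f p); last first.
  by apply: eq_bigr => p _; rewrite sumr_const /trace_pair_count cardsE.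
rewrite pair_big_dep (reindex_onto mk co) //=.
apply: eq_big => [[p z]|[p z] /andP[mkS /eqP <-]] /=; last by rewrite coK.
apply/andP/idP => [[mkS /eqP mkp]|pz]; first by have := co_inc _ mkS; rewrite mkp.
by rewrite mkK // eqxx; split=> //; case: (mkE _ _ pz).
Qed.

(** For fixed [z] the condition is affine in [p], with coefficient vector [z] up to order. *)
Lemma card_incident_line z : z != 0 -> #|[set p | incident p z]| = q.
Proof.
case: z => u v z0; have [u0|u0] := eqVneq u 0.
  have v0 : v != 0 by apply: contraNneq z0 => v0; rewrite u0 v0.
  pose f c : F * F := ((qform (u, v) + 1 - c * u) / v, c).
  rewrite -(card_imset predT (f := f)) => [|c c' []//]; apply: eq_card => -[a c].
  rewrite in_set; apply/eqP/imsetP => [/= e|[c' _ [-> ->]] /=].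
    by exists c => //; congr (_, _); apply: (canRL (mulfK v0)); rewrite -e; ring.
  by rewrite divfK //; ring.
pose f a : F * F := (a, (qform (u, v) + 1 - a * v) / u).
rewrite -(card_imset predT (f := f)) => [|c c' []//]; apply: eq_card => -[a c].
rewrite in_set; apply/eqP/imsetP => [/= e|[c' _ [-> ->]] /=].
  by exists a => //; congr (_, _); apply: (canRL (mulfK u0)); rewrite -e; ring.
by rewrite divfK //; ring.
Qed.

Lemma incident0 p : incident p 0 = false.
Proof. by rewrite /incident /qform /= !(mulr0, expr0n, addr0, add0r) eq_sym oner_eq0. Qed.

Definition qnormalize z : F * F := ((qform z)^-1 * z.1, (qform z)^-1 * z.2).

(* Two lines meet at most once unless they are parallel, and parallel lines    *)
(* with a common point have z' = z or z' = z / qform z.                        *)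
Lemma card_incident2 z z' :
  (#|[set p | incident p z && incident p z']| <=
     1 + q * (z' == z) + q * (z' == qnormalize z))%N.
Proof.
set S := [set p | _]; case: z z' @S => u v [u' v'] S.
(* A nonzero determinant means that the lines cross, and Cramer's rule gives at most one common
   point. *)
have [D0|D0] := eqVneq (u * v' - u' * v) 0; last first.
  rewrite -addnA (leq_trans _ (leq_addr _ _)) //; apply/card_le1_eqP.
  move=> [a' c'] [a c]; rewrite !in_set /incident /= => /andP[/eqP e3 /eqP e4].
  move=> /andP[/eqP e1 /eqP e2]; congr (_, _); apply/eqP; rewrite -subr_eq0.
    rewrite -(mulIr_eq0 _ (mulIf D0)); apply/eqP.
    transitivity (u * (c * u' + a * v' - (c' * u' + a' * v')) -
                  u' * (c * u + a * v - (c' * u + a' * v))); first by ring.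
    by rewrite e1 e2 e3 e4; ring.
  rewrite -(mulIr_eq0 _ (mulIf D0)); apply/eqP.
  transitivity (v' * (c * u + a * v - (c' * u + a' * v)) -
                v * (c * u' + a * v' - (c' * u' + a' * v'))); first by ring.
  by rewrite e1 e2 e3 e4; ring.
have [->|[[a c] /[!in_set]/andP[pz pz']]] := set_0Vmem S; first by rewrite cards0.
have z0 : (u, v) != 0 by apply: contraTneq pz => ->; rewrite incident0.
have Sq : (#|S| <= q)%N.
  rewrite -(card_incident_line z0); apply/subset_leq_card/subsetP=> p.
  by rewrite !in_set => /andP[].
have [l [lu lv]] : exists l, u' = l * u /\ v' = l * v.
  have [u0|u0] := eqVneq u 0.
    have v0 : v != 0 by apply: contraNneq z0 => v0; rewrite u0 v0.
    exists (v' / v); rewrite divfK // u0 mulr0; split=> //.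
    apply: (mulIf v0); rewrite mul0r; apply: oppr_inj; rewrite oppr0 -D0 u0; ring.
  exists (u' / u); rewrite divfK //; split=> //.
  apply: (mulIf u0); rewrite mulrAC divfK //; apply/eqP.
  by rewrite -subr_eq0 -D0; apply/eqP; ring.
have : (l * qform (u, v) - 1) * (l - 1) = 0.
  move/eqP: pz; move/eqP: pz'; rewrite lu lv /qform /= => e' e.
  have -> : (l * (u ^+ 2 + s * u * v + v ^+ 2) - 1) * (l - 1) =
    ((l * u) ^+ 2 + s * (l * u) * (l * v) + (l * v) ^+ 2 + 1)
    - l * (u ^+ 2 + s * u * v + v ^+ 2 + 1) by ring.
  by rewrite -e -e'; ring.
move/eqP; rewrite mulf_eq0 !subr_eq0 => /orP[/eqP lQ|/eqP l1].
  have Q0 : qform (u, v) != 0.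
    by apply/eqP=> Q0; move/eqP: lQ; rewrite Q0 mulr0 eq_sym oner_eq0.
  have -> : (u', v') = qnormalize (u, v).
    rewrite /qnormalize lu lv; suff -> : l = (qform (u, v))^-1 by [].
    by apply: (mulIf Q0); rewrite lQ mulVf.
  by rewrite /= eqxx muln1 (leq_trans Sq) // leq_addl.
by rewrite lu lv l1 !mul1r eqxx muln1 (leq_trans Sq) // addnAC leq_addl.
Qed.

Lemma sum_trace_pair_count : (\sum_p trace_pair_count p = q * (q ^ 2).-1)%N.
Proof.
transitivity (\sum_p \sum_(z | incident p z) 1)%N.
  by apply: eq_bigr => p _; rewrite sum1_card /trace_pair_count cardsE.
rewrite (exchange_big_dep predT) //= (bigD1 (0 : F * F)) //= big_pred0 => [|p]; last first.
  exact: incident0.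
rewrite add0n (eq_bigr (fun=> q)) => [|z z0]; last first.
  by rewrite sum1_card -(card_incident_line z0) cardsE.
by rewrite sum_nat_const cardC1 card_prod mulnC.
Qed.

(** The second moment counts points common to two lines: at most 1 for each pair (z, z'), plus q for
    each of the two exceptional z'. *)
Lemma sum_trace_pair_count_sqr :
  (\sum_p trace_pair_count p ^ 2 <= q ^ 4 + 2 * q ^ 3)%N.
Proof.
apply: (@leq_trans (\sum_z \sum_z' #|[set p | incident p z && incident p z']|)%N).
  rewrite leq_eqVlt; apply/orP; left; apply/eqP.
  transitivity (\sum_p \sum_z \sum_z' (incident p z && incident p z'))%N.
    apply: eq_bigr => p _; rewrite /trace_pair_count -sum1dep_card big_mkcond.
    rewrite expnS expn1 big_distrl; apply: eq_bigr => z _.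
    rewrite big_distrr; apply: eq_bigr => z' _.
    by case: (incident p z); case: (incident p z').
  rewrite exchange_big; apply: eq_bigr => z _; rewrite exchange_big.
  apply: eq_bigr => z' _; rewrite -sum1dep_card [RHS]big_mkcond.
  by apply: eq_bigr => p _; case: (_ && _).
pose B z z' := (1 + q * (z' == z) + q * (z' == qnormalize z))%N.
apply: (@leq_trans (\sum_z \sum_z' B z z')%N).
  by apply: leq_sum => z _; apply: leq_sum => z' _; apply: card_incident2.
rewrite /B (eq_bigr (fun=> q ^ 2 + 2 * q)%N) => [|z _]; last first.
  rewrite !big_split /= sum1_card card_prod -!big_distrr /=.
  have sum_eq1 (y : F * F) : (\sum_z' (z' == y) = 1)%N.
    by rewrite (bigD1 y) //= eqxx big1 // => z' /negPf ->.
  by rewrite !sum_eq1; ring.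
by rewrite sum_nat_const card_prod; apply/eq_leq; ring.
Qed.

End TracePairs.

Lemma card_SL2 (F : finFieldType) : #|SL2 F| = (#|F| * (#|F| ^ 2).-1)%N.
Proof.
have := sum_SL2_trace_pair (0 : F) (fun=> 1%N); rewrite sum1_card => ->.
by rewrite -(sum_trace_pair_count 0); apply: eq_bigr => p _; rewrite -mulr_natr natn mul1r.
Qed.

Section Equidistribution.
Variables (R : realFieldType) (F : finFieldType) (r : R).
Hypotheses (r_gt0 : 0 < r) (r2 : r ^+ 2 = #|F|%:R).
Notation q := (#|F|%:R : R).

(** The first two moments bound the sum of squared deviations by 4 q^3 over the q^2 pairs, so the
    typical deviation is of order r, against a mean close to q. *)
Lemma sum_trace_pair_dev s :
  \sum_(p : F * F) `|(trace_pair_count s p)%:R - q| <= 2 * r ^+ 5.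
Proof.
have F0 : (0 < #|F|)%N := ltnW (card_finNzRing_gt1 F).
have q0 : 1 <= q by rewrite ler1n.
have S1 : \sum_p (trace_pair_count s p)%:R = q * (q ^+ 2 - 1) :> R.
  by rewrite -natr_sum sum_trace_pair_count natrM -subn1 natrB ?expn_gt0 ?F0 // natrX.
have S2 : \sum_p (trace_pair_count s p)%:R ^+ 2 <= q ^+ 4 + 2 * q ^+ 3.
  rewrite -!natrX -natrM -natrD (le_trans _ (_ : (\sum_p trace_pair_count s p ^ 2)%:R <= _)) //.
    by rewrite natr_sum; apply: ler_sum => p _; rewrite natrX.
  by rewrite ler_nat sum_trace_pair_count_sqr.
have var : \sum_p ((trace_pair_count s p)%:R - q) ^+ 2 <= 4 * q ^+ 3.
  under eq_bigr do rewrite sqrrB.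
  rewrite big_split /= sumrB sumrMnl -mulr_suml S1 sumr_const card_prod.
  rewrite -[_ *+ (_ * _)]mulr_natr natrM -[_ *+ 2]mulr_natl.
  have q3 : 0 <= q ^+ 2 by rewrite exprn_ge0 // (le_trans _ q0).
  have : q ^+ 2 <= q ^+ 3 by rewrite exprS ler_peMl.
  move: S2; set X := \sum_p _; lra.
(* Replaces Cauchy-Schwarz; the weight is chosen so that both terms sum to at most r^5. *)
have am x : `|x| <= x ^+ 2 / (4 * r) + r :> R.
  rewrite -real_normK ?num_real // -subr_ge0.
  have -> : `|x| ^+ 2 / (4 * r) + r - `|x| = (`|x| - 2 * r) ^+ 2 / (4 * r).
    by field; rewrite gt_eqF.
  by rewrite divr_ge0 ?sqr_ge0 // mulr_ge0 // ltW.
apply: le_trans (ler_sum _ (fun p _ => am _)) _.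
rewrite big_split /= -mulr_suml sumr_const card_prod -[r *+ _]mulr_natr natrM -r2.
have -> : 2 * r ^+ 5 = 4 * q ^+ 3 / (4 * r) + r * (r ^+ 2 * r ^+ 2).
  by rewrite -r2; field; rewrite gt_eqF.
by rewrite lerD2r ler_pM2r ?invr_gt0 ?mulr_gt0 // r2.
Qed.

Lemma sum_SL2_equidist s (K : R) (f : F * F -> R) : (forall p, 0 <= f p <= K) ->
  `|\sum_(x in SL2 F) f (\tr (GLval x), \tr (GLval (x * companion s)%g))
    - q * \sum_p f p| <= K * (2 * r ^+ 5).
Proof.
move=> fK; rewrite (sum_SL2_trace_pair s f) mulr_sumr -sumrB.
apply: le_trans (ler_norm_sum _ _ _) _.
apply: le_trans (_ : K * \sum_p `|(trace_pair_count s p)%:R - q| <= _); last first.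
  rewrite ler_wpM2l ?sum_trace_pair_dev //.
  by have /andP[] := fK (0, 0); apply: le_trans.
rewrite mulr_sumr; apply: ler_sum => p _; have /andP[f0 fle] := fK p.
by rewrite -[f p *+ _]mulr_natl -mulrBl normrM mulrC (ger0_norm f0) ler_wpM2r.
Qed.

Lemma card_SL2R : #|SL2 F|%:R = q ^+ 3 - q :> R.
Proof.
rewrite card_SL2 natrM -subn1 natrB ?expn_gt0 ?(ltnW (card_finNzRing_gt1 F)) //.
by rewrite natrX; ring.
Qed.

End Equidistribution.

(** * Distributions on SL2 depending on the trace *)

Section ScalarSL2.
Variable F : finFieldType.
Implicit Types (g x z : {'GL_2[F]}).

(** The center of SL_2; its two elements coincide in characteristic 2. *)
Definition SL2_scalar : {set {'GL_2[F]}} := [set gl_of 1%:M; gl_of (-1)%:M].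

Lemma SL2_scalarP z :
  reflect (exists2 e : F, e ^+ 2 = 1 & GLval z = e%:M) (z \in SL2_scalar).
Proof.
have glE (e : F) : e ^+ 2 = 1 -> GLval (gl_of e%:M) = e%:M.
  by move=> e2; rewrite gl_ofE // det_scalar e2 oner_neq0.
apply: (iffP set2P) => [[->|->]|[e e2 ze]].
- by exists 1; rewrite ?expr1n // glE // expr1n.
- by exists (-1); rewrite ?sqrrN ?expr1n // glE // sqrrN expr1n.
have /eqP : e ^+ 2 = 1 ^+ 2 by rewrite e2 expr1n.
rewrite eqf_sqr => /orP[] /eqP ee; [left|right]; apply: GLval_inj.
  by rewrite ze ee glE // expr1n.
by rewrite ze ee glE // sqrrN expr1n.
Qed.

Lemma SL2_scalarM x z : x \in SL2_scalar -> z \in SL2_scalar ->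
  (x * z)%g \in SL2_scalar.
Proof.
move=> /SL2_scalarP[e e2 xe] /SL2_scalarP[f f2 zf].
apply/SL2_scalarP; exists (e * f); first by rewrite exprMn e2 f2 mulr1.
by rewrite GL_MxE xe zf scalar_mxM.
Qed.

Lemma SL2_scalarV z : (z^-1%g \in SL2_scalar) = (z \in SL2_scalar).
Proof.
suff imp y : y \in SL2_scalar -> (y^-1)%g \in SL2_scalar.
  by apply/idP/idP => /imp; rewrite ?invgK.
move=> /SL2_scalarP[e e2 ye]; apply/SL2_scalarP; exists e => //.
suff -> : (y^-1 = y)%g by [].
apply: (mulgI y); rewrite mulgV; apply: GLval_inj.
by rewrite GL_1E GL_MxE ye -scalar_mxM -expr2 e2.
Qed.

Lemma card_SL2_scalar : (#|SL2_scalar| <= 2)%N.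
Proof. by rewrite cards2; case: (_ != _). Qed.

Lemma companion_nonscalar s : companion s \notin SL2_scalar.
Proof.
apply/SL2_scalarP=> -[e _ /matrixP/(_ 1 0)].
by rewrite companion_SL2 mx2E !mxE /= => /eqP; rewrite oner_eq0.
Qed.

Lemma SL2_norm x : x \in 'N(SL2 F)%g.
Proof.
rewrite inE; apply/subsetP=> _ /imsetP[g /SL2P dg ->]; apply/SL2P.
by rewrite !det_mulmx dg mul1r det_inv mulVf // GL_det.
Qed.

Lemma word_dist_SL2_conj (R : realFieldType) (d : nat) (w : free_group d) g x :
  word_dist R (SL2 F) w (g ^ x)%g = word_dist R (SL2 F) w g.
Proof. exact: (word_dist_conj R w g (SL2_norm x)). Qed.

(* The conjugating matrix has columns v and g v, for v not an eigenvector. *)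
Lemma SL2_conj_companion g : g \in SL2 F -> g \notin SL2_scalar ->
  exists x, (g ^ x)%g = companion (\tr (GLval g)).
Proof.
move=> gS gZ; have /SL2P := gS; rewrite det_mx2 mxtrace2.
set a := GLval g 0 0; set b := GLval g 0 1; set c := GLval g 1 0.
set d := GLval g 1 1 => dg.
(* If both basis vectors are eigenvectors, g is diagonal, and their sum is an eigenvector only when
   g is scalar. *)
have [u [v uv]] : exists u v, u * (c * u + d * v) - (a * u + b * v) * v != 0.
  have [c0|c0] := eqVneq c 0; last first.
    by exists 1, 0; rewrite !(mulr1, mulr0, addr0, mul1r, subr0).
  have [b0|b0] := eqVneq b 0; last first.
    by exists 0, 1; rewrite !(mulr1, mulr0, add0r, mul0r, sub0r) oppr_eq0.
  exists 1, 1; rewrite c0 b0 !mulr1 !mul1r add0r addr0.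
  apply: contraNneq gZ => /eqP; rewrite subr_eq0 => /eqP da.
  apply/SL2_scalarP; exists a; first by rewrite -dg c0 da mulr0 subr0 expr2.
  apply: mx2P; rewrite [RHS]mxE //= ?mulr1n ?mulr0n //.
have detX : \det (mx2 u (a * u + b * v) v (c * u + d * v)) != 0.
  by rewrite det_mx2 !mx2E.
exists (gl_of (mx2 u (a * u + b * v) v (c * u + d * v))).
rewrite conjgE; apply: (mulgI (gl_of (mx2 u (a * u + b * v) v (c * u + d * v)))).
rewrite mulKVg; apply: GLval_inj; rewrite !GL_MxE companion_SL2 gl_ofE //.
(* The second column is Cayley-Hamilton: g^2 v = tr(g) g v - v. *)
apply: mx2P; rewrite !mulmx2E !mx2E -/a -/b -/c -/d; [by ring| |by ring|].
  transitivity (- u * (a * d - b * c) + (a * u + b * v) * (a + d)); first by ring.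
  by rewrite dg; ring.
transitivity (- v * (a * d - b * c) + (c * u + d * v) * (a + d)); first by ring.
by rewrite dg; ring.
Qed.

Lemma mxtrace_SL2V x : x \in SL2 F -> \tr (GLval x^-1%g) = \tr (GLval x).
Proof. by move=> xS; rewrite SL2_invE // !mxtrace2 !mx2E addrC. Qed.

End ScalarSL2.

(** * The two classes of distributions, and single words *)

Section Estimates.
Variables (R : realFieldType) (F : finFieldType) (r : R).
Hypotheses (r_gt0 : 0 < r) (r2 : r ^+ 2 = #|F|%:R).
Notation q := (#|F|%:R : R).
Notation gT := {'GL_2[F]}.
Notation S := (SL2 F).
Notation Z := (SL2_scalar F).
Notation N := (#|SL2 F|%:R : R).
Implicit Types (p : gT -> R) (C E : R).

Definition traceform_bound C p :=
  [/\ forall g, 0 <= p g, \sum_(g in S) p g = 1,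
      forall z, z \in Z -> p z <= C / q &
      exists2 a : F -> R, forall c, 0 <= a c <= C / q ^+ 3 &
        forall g, g \in S -> g \notin Z -> p g = a (\tr (GLval g))].

Definition nearly_uniform E p :=
  (forall g, g \in S -> g \notin Z -> `|N * p g - 1| <= E / r) /\
  (forall z, z \in Z -> p z <= E / q ^+ 2).

Lemma q_ge2 : 2 <= q.
Proof. by rewrite ler_nat card_finNzRing_gt1. Qed.

Lemma r_ge1 : 1 <= r.
Proof.
rewrite -(@ler_pXn2r _ 2) ?nnegrE ?ler01 ?ltW // expr1n r2.
by have := q_ge2; lra.
Qed.

(** The mass of a trace bounds a central element at once. Off the center, the q(q-1) matrices of
    trace c with nonzero upper right entry are all conjugate to [companion c] and share mass at most
    2n/q, where n is the length of [w]; since q <= 2(q-1), each has mass at most 4n/q^3. *)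
Lemma traceform_word (d : nat) (w : free_group d) C : w <> 1%g ->
  (4 * size (letters w))%:R <= C -> traceform_bound C (word_dist R S w).
Proof.
move=> w1 nC; set n := size (letters w) in nC.
have q0 : 0 < q by have := q_ge2; lra.
have n0 : 0 <= n%:R :> R := ler0n _ _.
have trP (c : F) : \sum_(g in S | \tr (GLval g) == c) word_dist R S w g <=
    2 * n%:R / q.
  rewrite -mulr_suml -natr_sum (sum_word_count S w (fun g => \tr (GLval g) == c)).
  rewrite ler_pdivrMr ?exprn_gt0 ?natG_gt0 // mulrAC ler_pdivlMr //.
  rewrite mulrC -natrX -!natrM ler_nat; exact: card_trace_word.
split=> [g||z zZ|]; [exact: word_dist_ge0|exact: sum_word_dist| |].
  have zS : z \in S.
    by have /SL2_scalarP[e e2 ze] := zZ; apply/SL2P; rewrite ze det_scalar.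
  apply: (@le_trans _ _ (2 * n%:R / q)).
    apply: le_trans (trP (\tr (GLval z))); rewrite (bigD1 z) ?zS ?eqxx //= lerDl.
    by apply: sumr_ge0 => g _; apply: word_dist_ge0.
  rewrite ler_pM2r ?invr_gt0 //; move: nC; rewrite natrM; lra.
exists (fun c => word_dist R S w (companion c)) => [c|g gS gZ]; last first.
  have [x <-] := SL2_conj_companion gS gZ.
  by rewrite word_dist_SL2_conj.
rewrite word_dist_ge0 /=; set al := word_dist R S w _.
pose f (xy : F * F) : gT :=
  gl_of (mx2 xy.1 xy.2 ((xy.1 * (c - xy.1) - 1) / xy.2) (c - xy.1)).
have fG xy : xy.2 != 0 -> GLval (f xy) =
    mx2 xy.1 xy.2 ((xy.1 * (c - xy.1) - 1) / xy.2) (c - xy.1).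
  by move=> y0; apply: (gl_of_SL2 _).1; rewrite det_mx2 !mx2E; field.
have fS xy : xy.2 != 0 -> f xy \in S.
  by move=> y0; apply: (gl_of_SL2 _).2; rewrite det_mx2 !mx2E; field.
have ftr xy : xy.2 != 0 -> \tr (GLval (f xy)) = c.
  by move=> y0; rewrite mxtrace2 fG // !mx2E subrKC.
pose D := [set xy : F * F | xy.2 != 0].
have cardD : #|D| = (#|F| * #|F|.-1)%N.
  have -> : D = setX [set: F] [set~ 0] by apply/setP=> xy; rewrite !inE.
  by rewrite cardsX cardsT cardsC1.
have f_inj : {in D &, injective f}.
  move=> [x y] [x' y']; rewrite !in_set => y0 y'0 /(congr1 GLval).
  rewrite !fG // => /matrixP e; have := e 0 0; have := e 0 1.
  by rewrite !mx2E /= => -> ->.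
have : al *+ (#|F| * #|F|.-1) <= 2 * n%:R / q.
  rewrite -cardD -(card_in_imset f_inj) -sumr_const.
  apply: le_trans (trP c).
  rewrite [leRHS]big_mkcond [leLHS]big_mkcond /=; apply: ler_sum => g _.
  case: ifP => [/imsetP[xy]|_]; last first.
    by case: ifP => // _; apply: word_dist_ge0.
  rewrite in_set => y0 ->; rewrite (fS _ y0) (ftr _ y0) eqxx /=.
  have fZ : f xy \notin Z.
    apply/SL2_scalarP=> -[e _ /matrixP/(_ 0 1)].
    by rewrite fG // mx2E !mxE => /eqP; rewrite (negPf y0).
  have [x] := SL2_conj_companion (fS _ y0) fZ.
  by rewrite (ftr _ y0) /al => <-; rewrite word_dist_SL2_conj.
rewrite -[al *+ _]mulr_natr natrM -subn1 natrB; last by apply: ltnW (card_finNzRing_gt1 F).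
have al0 : 0 <= al by apply: word_dist_ge0.
have q2 := q_ge2.
rewrite ler_pdivlMr // ler_pdivlMr ?exprn_gt0 // => le2n.
move: nC; rewrite natrM; apply: le_trans.
have : al * q ^+ 3 <= 2 * (al * (q * (q - 1)) * q).
  have -> : 2 * (al * (q * (q - 1)) * q) = al * q ^+ 3 + al * q ^+ 2 * (q - 2) by ring.
  by rewrite lerDl mulr_ge0 ?subr_ge0 // mulr_ge0 ?exprn_ge0 // ltW.
move=> le3; apply: le_trans le3 _; lra.
Qed.

(** At most four x have [x] or [x * g] central; these pay [D], all others [e]. *)
Lemma sum_off_scalar (a : gT -> R) g D e : g \in S -> 0 <= e -> 0 <= D ->
  (forall x, x \in S -> x \notin Z -> (x * g)%g \notin Z -> `|a x| <= e) ->
  (forall x, x \in S -> `|a x| <= D) ->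
  \sum_(x in S) `|a x| <= 4 * D + N * e.
Proof.
move=> gS e0 D0 ae aD.
have cardZ : #|Z|%:R <= 2 :> R by rewrite (ler_nat R _ 2) card_SL2_scalar.
have sZ (A : {set gT}) : (\sum_(x in S) (x \in A)%:R <= #|A|%:R :> R).
  rewrite -natr_sum ler_nat -sum1_card [leqRHS]big_mkcond /=.
  rewrite [leqLHS]big_mkcond /=; apply: leq_sum => x _.
  by case: ifP; case: (x \in A).
have := lerD (sZ Z) (sZ [set z * g^-1 | z in Z]%g).
rewrite card_imset; last exact: mulIg.
move=> sle; apply: (@le_trans _ _ (\sum_(x in S)
    (e + (D * (x \in Z)%:R + D * (x \in [set z * g^-1 | z in Z]%g)%:R)))).
  apply: ler_sum => x xS.
  have [xZ|xZ] := boolP (x \in Z).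
    rewrite mulr1; apply: le_trans (aD x xS) _.
    by rewrite addrCA lerDl addr_ge0 // mulr_ge0.
  have [xgZ|xgZ] := boolP (x \in [set z * g^-1 | z in Z]%g).
    rewrite mulr1 mulr0 add0r; apply: le_trans (aD x xS) _.
    by rewrite lerDr.
  rewrite !mulr0 !addr0; apply: ae => //; apply: contraNN xgZ => xgZ.
  by apply/imsetP; exists (x * g)%g; rewrite ?mulgK.
rewrite !big_split /= sumr_const -!mulr_sumr -mulrDr -[e *+ _]mulr_natl.
rewrite [leLHS]addrC lerD2r.
rewrite [4 * D]mulrC ler_wpM2l // (le_trans sle) //.
by move: cardZ; lra.
Qed.

End Estimates.

(** * Convolutions on SL2 *)

Section Convolution.
Variables (R : realFieldType) (F : finFieldType) (r : R).
Hypotheses (r_gt0 : 0 < r) (r2 : r ^+ 2 = #|F|%:R).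
Notation q := (#|F|%:R : R).
Notation gT := {'GL_2[F]}.
Notation S := (SL2 F).
Notation Z := (SL2_scalar F).
Notation N := (#|SL2 F|%:R : R).
Notation u := (r^-1).
Implicit Types (p : gT -> R) (C E : R).

Let q2 : 2 <= q := q_ge2 R F.

Let u_gt0 : 0 < u.
Proof. by rewrite invr_gt0. Qed.

Let u_le1 : u <= 1.
Proof. by rewrite invf_le1 // (r_ge1 r_gt0 r2). Qed.

Let qu : q * u ^+ 2 = 1.
Proof. by rewrite -r2 -exprMn divff ?expr1n // gt_eqF. Qed.

Let ru : r * u = 1.
Proof. by rewrite divff // gt_eqF. Qed.

Let qV n : (q ^+ n)^-1 = u ^+ (2 * n).
Proof. by rewrite -r2 -exprM exprVn. Qed.

Let N_le : N <= q ^+ 3.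
Proof. by rewrite card_SL2R; move: q2; lra. Qed.

Let u_leX n : u ^+ n.+1 <= u.
Proof. by rewrite exprS ler_piMr ?exprn_ile1 // ltW. Qed.

Lemma traceform_le C p g : traceform_bound C p -> g \in S -> 0 <= p g <= C * u ^+ 2.
Proof.
case=> p0 _ pZ [a aB pa] gS; rewrite p0 /=.
have [gZ|gZ] := boolP (g \in Z); first by rewrite -(qV 1) pZ.
rewrite pa //; have /andP[a0 ale] := aB (\tr (GLval g)).
have C0 : 0 <= C by have := le_trans a0 ale; rewrite pmulr_lge0 // qV exprn_gt0.
by apply: le_trans ale _; rewrite qV ler_wpM2l // ler_wiXn2l // ltW.
Qed.

Lemma ler_dist_itv (x y D : R) : 0 <= x <= D -> 0 <= y <= D -> `|x - y| <= D.
Proof. by move=> /andP[? ?] /andP[? ?]; rewrite ler_norml; apply/andP; split; lra. Qed.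

Lemma sum_near_scalar (a b : gT -> R) g D : g \in S -> 0 <= D ->
  (forall x, x \in S -> x \notin Z -> (x * g)%g \notin Z -> a x = b x) ->
  (forall x, x \in S -> (0 <= a x <= D) && (0 <= b x <= D)) ->
  `|\sum_(x in S) a x - \sum_(x in S) b x| <= 4 * D.
Proof.
move=> gS D0 ab abD; rewrite -sumrB; apply: le_trans (ler_norm_sum _ _ _) _.
have := @sum_off_scalar R F (fun x => a x - b x) g D 0 gS (lexx 0) D0.
rewrite mulr0 addr0; apply=> [x xS xZ xgZ|x xS].
  by rewrite ab // subrr normr0.
by have /andP[? ?] := abD x xS; apply: ler_dist_itv.
Qed.

(** Summing a(tr x) over SL_2 recovers the total mass 1 up to the center, while equidistribution of
    the first trace alone makes it about q^2 times the sum of [a]. *)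
Lemma traceform_mass C p (a : F -> R) : 0 <= C -> traceform_bound C p ->
  (forall c, 0 <= a c <= C * u ^+ 6) ->
  (forall g, g \in S -> g \notin Z -> p g = a (\tr (GLval g))) ->
  `|q ^+ 2 * (\sum_c a c) - 1| <= 6 * C * u.
Proof.
move=> C0 tp aB pa; have [_ p1 _ _] := tp.
have d1 : `|\sum_(x in S) a (\tr (GLval x)) - 1| <= 4 * (C * u ^+ 2).
  rewrite -[X in _ - X]p1; apply: (sum_near_scalar (group1 _)) => [|x xS xZ _|x xS].
  - by rewrite mulr_ge0 // exprn_ge0 // ltW.
  - by rewrite pa.
  rewrite (traceform_le tp xS) andbT.
  have /andP[-> ale] := aB (\tr (GLval x)); apply: le_trans ale _.
  by rewrite ler_wpM2l // ler_wiXn2l // ltW.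
have := sum_SL2_equidist r_gt0 r2 0 (f := fun c => a c.1) (fun c => aB c.1).
have -> : \sum_(c : F * F) a c.1 = q * \sum_c a c.
  rewrite -(pair_bigA _ (fun c _ => a c)) mulr_sumr /=.
  by apply: eq_bigr => c _; rewrite sumr_const mulr_natl.
set T := \sum_(x in S) _; rewrite -/T in d1.
have -> : C * u ^+ 6 * (2 * r ^+ 5) = 2 * C * u.
  have -> : C * u ^+ 6 * (2 * r ^+ 5) = 2 * C * u * (r * u) ^+ 5 by ring.
  by rewrite ru expr1n mulr1.
move=> d2; rewrite expr2 -mulrA.
have -> : q * (q * \sum_c a c) - 1 = (T - 1) - (T - q * (q * \sum_c a c)) by ring.
apply: le_trans (ler_normB _ _) _; apply: le_trans (lerD d1 d2) _.
have : C * u ^+ 2 <= C * u by rewrite ler_wpM2l // u_leX.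
lra.
Qed.

(** Off the center, [p1] and [p2] may be replaced by their trace functions a and b at the cost of
    four terms. Equidistribution then turns the sum into q (sum a)(sum b), and each factor is about
    q^-2. *)
Lemma conv_nearly_uniform C p1 p2 P : 1 <= C ->
  traceform_bound C p1 -> traceform_bound C p2 ->
  (forall g x, P (g ^ x)%g = P g) ->
  (forall g, g \in S -> P g = \sum_(x in S) p1 x^-1%g * p2 (x * g)%g) ->
  nearly_uniform r (103 * C ^+ 2) P.
Proof.
move=> C1 tp1 tp2 PJ PE; have C0 : 0 <= C by lra.
have [p1_ge0 _ _ [a aB p1a]] := tp1; have [p2_ge0 p2_sum _ [b bB p2b]] := tp2.
have {}aB c : 0 <= a c <= C * u ^+ 6 by have := aB c; rewrite qV.
have {}bB c : 0 <= b c <= C * u ^+ 6 by have := bB c; rewrite qV.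
have CC : C <= C ^+ 2 by rewrite expr2 ler_peMl.
have un n : 0 <= u ^+ n by rewrite exprn_ge0 // ltW.
have Cun n : 0 <= C * u ^+ n by apply: mulr_ge0.
have p1V x : x \in S -> x \notin Z -> p1 x^-1%g = a (\tr (GLval x)).
  by move=> xS xZ; rewrite p1a ?SL2V ?SL2_scalarV // mxtrace_SL2V.
split=> [g gS gZ|z zZ].
  have [x gx] := SL2_conj_companion gS gZ.
  rewrite -(PJ g x) gx; move: (\tr _) => s {g gS gZ x gx}.
  have cS : companion s \in S := (companion_SL2 s).2.
  pose D := C * u ^+ 2 * (C * u ^+ 6).
  have D0 : 0 <= D by apply: mulr_ge0.
  pose T := \sum_(x in S) a (\tr (GLval x)) * b (\tr (GLval (x * companion s)%g)).
  have d1 : `|P (companion s) - T| <= 4 * D.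
    rewrite PE //; apply: (sum_near_scalar cS) => // [x xS xZ xcZ|x xS].
      by rewrite p1V // p2b //; apply: SL2M.
    have xcS := SL2M xS cS; apply/andP; split; last first.
      have /andP[a0 ale] := aB (\tr (GLval x)).
      have /andP[b0 ble] := bB (\tr (GLval (x * companion s)%g)).
      rewrite mulr_ge0 // ler_pM // (le_trans ale) // ler_wpM2l //.
      by rewrite ler_wiXn2l // ltW.
    have [xZ|xZ] := boolP (x \in Z).
      (* The two arguments are never both central, so at least one factor has the small bound C u^6;
         the four exceptional terms would otherwise be too large. *)
      have xcZ : (x * companion s)%g \notin Z.
        apply: contraNN (companion_nonscalar s) => xcZ.
        by rewrite -(mulKg x (companion s)) SL2_scalarM ?SL2_scalarV.
      rewrite p2b //; have /andP[b0 ble] := bB (\tr (GLval (x * companion s)%g)).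
      have /andP[_ ple] := traceform_le tp1 (SL2V xS).
      by rewrite mulr_ge0 // ler_pM.
    rewrite p1V //; have /andP[a0 ale] := aB (\tr (GLval x)).
    have /andP[_ ple] := traceform_le tp2 xcS.
    by rewrite mulr_ge0 //= /D mulrC ler_pM.
  pose A := \sum_c a c; pose B := \sum_c b c.
  have d2 : `|T - q * (A * B)| <= 2 * C ^+ 2 * u ^+ 7.
    have -> : A * B = \sum_(c : F * F) a c.1 * b c.2.
      rewrite -(pair_bigA _ (fun c e => a c * b e)) /= /A mulr_suml.
      by apply: eq_bigr => c _; rewrite mulr_sumr.
    have -> : 2 * C ^+ 2 * u ^+ 7 = C * u ^+ 6 * (C * u ^+ 6) * (2 * r ^+ 5).
      have -> : C * u ^+ 6 * (C * u ^+ 6) * (2 * r ^+ 5) =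
        2 * C ^+ 2 * u ^+ 7 * (r * u) ^+ 5 by ring.
      by rewrite ru expr1n mulr1.
    apply: (sum_SL2_equidist r_gt0 r2 s (f := fun c => a c.1 * b c.2)) => c.
    have /andP[a0 ale] := aB c.1; have /andP[b0 ble] := bB c.2.
    by rewrite mulr_ge0 // ler_pM.
  have X1 : `|q ^+ 2 * A - 1| <= 6 * C * u := traceform_mass C0 tp1 aB p1a.
  have Y1 : `|q ^+ 2 * B - 1| <= 6 * C * u := traceform_mass C0 tp2 bB p2b.
  set X := q ^+ 2 * A in X1; set Y := q ^+ 2 * B in Y1.
  have XY : `|X * Y - 1| <= 48 * C ^+ 2 * u.
    have -> : X * Y - 1 = (X - 1) * (Y - 1) + ((X - 1) + (Y - 1)) by ring.
    apply: le_trans (ler_normD _ _) _; rewrite normrM.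
    have := ler_pM (normr_ge0 _) (normr_ge0 _) X1 Y1.
    have -> : 6 * C * u * (6 * C * u) = 36 * (C ^+ 2 * u ^+ 2) by ring.
    have : C ^+ 2 * u ^+ 2 <= C ^+ 2 * u by rewrite ler_wpM2l ?exprn_ge0 // u_leX.
    have : C * u <= C ^+ 2 * u by rewrite ler_wpM2r // ltW.
    have := le_trans (ler_normD (X - 1) (Y - 1)) (lerD X1 Y1).
    lra.
  have XYu : `|X * Y * u ^+ 4| <= 49 * C ^+ 2 * u.
    rewrite normrM (ger0_norm (un 4)).
    have XYle : `|X * Y| <= 49 * C ^+ 2.
      have := ler_normD (X * Y - 1) 1; rewrite subrK normr1.
      have : C ^+ 2 * u <= C ^+ 2 by rewrite ler_piMr // exprn_ge0.
      have : 1 <= C ^+ 2 by lra.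
      by move: XY; lra.
    by rewrite ler_pM // u_leX.
  (* The correction term comes from N = q^3 - q. *)
  have NqAB : N * (q * (A * B)) = X * Y - X * Y * u ^+ 4.
    rewrite card_SL2R /X /Y.
    have -> : q ^+ 2 * A * (q ^+ 2 * B) * u ^+ 4 = (q * u ^+ 2) ^+ 2 * (q ^+ 2 * (A * B)).
      by ring.
    by rewrite qu; ring.
  have -> : N * P (companion s) - 1 = N * (P (companion s) - T) +
     (N * (T - q * (A * B)) + ((X * Y - 1) - X * Y * u ^+ 4)).
    by rewrite [in RHS]mulrBr [N * (T - _)]mulrBr NqAB; ring.
  have N0 : 0 <= N := ler0n _ _.
  have qu6 : q ^+ 3 * u ^+ 6 = 1.
    have -> : q ^+ 3 * u ^+ 6 = (q * u ^+ 2) ^+ 3 by ring.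
    by rewrite qu expr1n.
  have e1 : `|N * (P (companion s) - T)| <= 4 * C ^+ 2 * u.
    rewrite normrM (ger0_norm N0).
    apply: le_trans (ler_pM N0 (normr_ge0 _) N_le d1) _.
    have -> : q ^+ 3 * (4 * D) = 4 * (C ^+ 2 * u ^+ 2) * (q ^+ 3 * u ^+ 6).
      by rewrite /D; ring.
    by rewrite qu6 mulr1 -mulrA ler_pM2l // ler_wpM2l ?exprn_ge0 // u_leX.
  have e2 : `|N * (T - q * (A * B))| <= 2 * C ^+ 2 * u.
    rewrite normrM (ger0_norm N0).
    apply: le_trans (ler_pM N0 (normr_ge0 _) N_le d2) _.
    have -> : q ^+ 3 * (2 * C ^+ 2 * u ^+ 7) = 2 * C ^+ 2 * u * (q ^+ 3 * u ^+ 6).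
      by ring.
    by rewrite qu6 mulr1.
  (* The constant is 103 = 4 + 2 + 48 + 49, from [e1], [e2], [XY] and [XYu]. *)
  have e3 := le_trans (ler_normB (X * Y - 1) (X * Y * u ^+ 4)) (lerD XY XYu).
  have := le_trans (ler_normD (N * (T - q * (A * B))) _) (lerD e2 e3).
  move=> e23; apply: le_trans (ler_normD _ _) _; apply: le_trans (lerD e1 e23) _.
  by lra.
have zS : z \in S.
  by have /SL2_scalarP[e e2 ze] := zZ; apply/SL2P; rewrite ze det_scalar.
have sum_p2 : \sum_(x in S) p2 (x * z)%g = 1.
  rewrite -p2_sum [RHS](reindex_inj (mulIg z)); apply: eq_bigl => x.
  apply/idP/idP=> [xS|xzS]; first exact: SL2M.
  by rewrite -(mulgK z x); apply: SL2M (SL2V zS).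
rewrite PE // qV.
(* The at most two central x contribute (C/q)^2 each; the others are bounded by the maximum of a
   against the total mass 1 of [p2]. *)
apply: (@le_trans _ _ (\sum_(x in S)
   (C * u ^+ 2 * (C * u ^+ 2) * (x \in Z)%:R + C * u ^+ 6 * p2 (x * z)%g))).
  apply: ler_sum => x xS; have /andP[_ l1] := traceform_le tp1 (SL2V xS).
  have /andP[_ l2] := traceform_le tp2 (SL2M xS zS).
  have [xZ|xZ] := boolP (x \in Z).
    rewrite mulr1; apply: le_trans (_ : C * u ^+ 2 * (C * u ^+ 2) <= _).
      by rewrite ler_pM.
    by rewrite lerDl mulr_ge0.
  rewrite mulr0 add0r ler_wpM2r // p1V //.
  by have /andP[] := aB (\tr (GLval x)).
rewrite big_split /= -!mulr_sumr sum_p2 mulr1.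
have Z2 : \sum_(x in S) (x \in Z)%:R <= 2 :> R.
  rewrite -natr_sum (ler_nat R _ 2); apply: leq_trans (card_SL2_scalar F).
  rewrite -sum1_card big_mkcond [leqRHS]big_mkcond /=.
  by apply: leq_sum => x _; case: ifP; case: (x \in Z).
have C0' : 0 <= C * u ^+ 2 * (C * u ^+ 2) by apply: mulr_ge0.
have := ler_wpM2l C0' Z2.
have -> : C * u ^+ 2 * (C * u ^+ 2) * 2 = 2 * (C ^+ 2 * u ^+ 4) by ring.
have : C * u ^+ 6 <= C ^+ 2 * u ^+ 4.
  by rewrite ler_pM // ler_wiXn2l // ltW.
have : 0 <= C ^+ 2 * u ^+ 4 by rewrite mulr_ge0 // exprn_ge0.
by rewrite /= -mulrA; lra.
Qed.

(** Each normalized term is 1 + O(u) unless one of its arguments is central. The at most four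
    exceptional terms are of size at most (qE)^2, negligible after division by N, which is of order
    q^3; here 11 = 3 + 8. *)
Lemma conv_uniform E P Q T g : 1 <= E ->
  nearly_uniform r E P -> nearly_uniform r E Q ->
  (forall x, 0 <= P x) -> (forall x, 0 <= Q x) -> g \in S ->
  T = \sum_(x in S) P x^-1%g * Q (x * g)%g ->
  `|N * T - 1| <= 11 * E ^+ 2 * u.
Proof.
move=> E1 [PN PZ] [QN QZ] P0 Q0 gS ->.
have E0 : 0 <= E by lra.
have N0 : 0 < N := natG_gt0 R (SL2 F).
have EE : E <= E ^+ 2 by rewrite expr2 ler_peMl.
have u0 := ltW u_gt0.
have Eu : E * u <= E by rewrite ler_piMr.
(* A crude density bound, which also covers the central elements, where N E / q^2 <= qE. *)
have le_qE (V : gT -> R) : (forall x, x \in S -> x \notin Z -> `|N * V x - 1| <= E / r) ->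
    (forall z, z \in Z -> V z <= E / q ^+ 2) -> forall x, x \in S -> N * V x <= q * E.
  move=> VN VZ x xS; have [xZ|xZ] := boolP (x \in Z).
    apply: le_trans (_ : N * (E / q ^+ 2) <= _); first by rewrite ler_wpM2l ?VZ // ltW.
    apply: le_trans (_ : q ^+ 3 * (E / q ^+ 2) <= _).
      by rewrite ler_wpM2r // divr_ge0 // exprn_ge0.
    rewrite qV; have -> : q ^+ 3 * (E * u ^+ (2 * 2)) = q * E * (q * u ^+ 2) ^+ 2 by ring.
    by rewrite qu expr1n mulr1.
  have := ler_norm (N * V x - 1); have := VN x xS xZ.
  have : 2 * E <= q * E by rewrite ler_wpM2r.
  lra.
pose a x := N ^+ 2 * (P x^-1%g * Q (x * g)%g) - 1.
have -> : N * (\sum_(x in S) P x^-1%g * Q (x * g)%g) - 1 = N^-1 * \sum_(x in S) a x.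
  rewrite sumrB -mulr_sumr sumr_const expr2 -mulrA mulrBr mulKf ?gt_eqF //.
  by rewrite mulVf // gt_eqF.
rewrite normrM gtr0_norm ?invr_gt0 //.
have aE x : a x = (N * P x^-1%g) * (N * Q (x * g)%g) - 1 by rewrite /a; ring.
have q0 : 0 < q by move: q2; lra.
have suma : \sum_(x in S) `|a x| <= 4 * (q * E * (q * E)) + N * (3 * E ^+ 2 * u).
  apply: (sum_off_scalar gS).
  - by rewrite !mulr_ge0 ?exprn_ge0.
  - by rewrite !mulr_ge0 // ltW.
  - move=> x xS xZ xgZ.
    have := PN x^-1%g (SL2V xS); rewrite SL2_scalarV => /(_ xZ).
    have := QN _ (SL2M xS gS) xgZ; rewrite aE.
    move: (N * P _) (N * Q _) => U V V1 U1.
    have -> : U * V - 1 = (U - 1) * (V - 1) + ((U - 1) + (V - 1)) by ring.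
    apply: le_trans (ler_normD _ _) _; rewrite normrM.
    have := ler_pM (normr_ge0 _) (normr_ge0 _) U1 V1.
    have -> : E / r * (E / r) = E ^+ 2 * u ^+ 2 by ring.
    have : E ^+ 2 * u ^+ 2 <= E ^+ 2 * u by rewrite ler_wpM2l ?exprn_ge0 // u_leX.
    have : E * u <= E ^+ 2 * u by rewrite ler_wpM2r.
    have := le_trans (ler_normD (U - 1) (V - 1)) (lerD U1 V1).
    lra.
  move=> x xS; rewrite aE; apply: ler_dist_itv.
    by rewrite !mulr_ge0 ?(ltW N0) // ler_pM ?mulr_ge0 ?(ltW N0) //;
      apply: le_qE => //; [apply: SL2V|apply: SL2M].
  rewrite ler01 /= -[leLHS]mulr1.
  have qE1 : 1 <= q * E by rewrite -[leLHS]mulr1 ler_pM //; move: q2; lra.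
  by rewrite ler_pM.
apply: le_trans (ler_wpM2l _ (le_trans (ler_norm_sum _ _ _) suma)) _.
  by rewrite invr_ge0 ltW.
rewrite mulrDr mulKf ?gt_eqF // addrC.
have -> : 11 * E ^+ 2 * u = 3 * E ^+ 2 * u + 8 * E ^+ 2 * u by ring.
rewrite lerD2l mulrC ler_pdivrMr //.
have Nq : q ^+ 3 <= 2 * N.
  rewrite card_SL2R; have : 4 * q <= q ^+ 3.
    have -> : 4 * q = 2 * 2 * q by ring.
    by rewrite exprSr ler_wpM2r ?(ltW q0) // expr2 ler_pM.
  lra.
have -> : 4 * (q * E * (q * E)) = 4 * E ^+ 2 * u ^+ 2 * q ^+ 3.
  have -> : 4 * E ^+ 2 * u ^+ 2 * q ^+ 3 = 4 * (q * E * (q * E)) * (q * u ^+ 2) by ring.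
  by rewrite qu mulr1.
have -> : 8 * E ^+ 2 * u * N = 4 * E ^+ 2 * u * (2 * N) by ring.
by rewrite ler_pM ?mulr_ge0 ?exprn_ge0 ?ler_wpM2l ?mulr_ge0 ?exprn_ge0 ?(ltW q0) // u_leX.
Qed.

End Convolution.

(** * Four disjoint words *)

Lemma word_in_sub (d : nat) (X Y : {set 'I_d}) (w : free_group d) :
  X \subset Y -> word_in X w -> word_in Y w.
Proof. by move=> /subsetP XY; apply: sub_all => a /XY. Qed.

Lemma disjoint_words4 (d : nat) (w1 w2 w3 w4 : free_group d) :
  pairwise_disjoint_words [:: w1; w2; w3; w4] ->
  exists X1 X X3 : {set 'I_d},
  [/\ word_in X1 w1 /\ word_in (~: X1) w2, word_in X3 w3 /\ word_in (~: X3) w4 &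
      word_in X (w1 * w2)%g /\ word_in (~: X) (w3 * w4)%g].
Proof.
case=> -[|X1 [|X2 [|X3 [|X4 [|X5 Xs]]]]] //=; rewrite ?andbF // !andbT.
move=> /and4P[X1w X2w X3w X4w] /and3P[/and3P[d12 d13 d14] /andP[d23 d24] d34].
have sub (X Y : {set 'I_d}) : [disjoint X & Y] -> Y \subset ~: X.
  by rewrite disjoint_sym disjoints_subset.
exists X1, (X1 :|: X2), X3; split; split=> //; try exact: word_inM.
- exact: word_in_sub (sub _ _ d12) X2w.
- exact: word_in_sub (sub _ _ d34) X4w.
apply: (word_in_sub _ (word_inM X3w X4w)).
by rewrite setCU subsetI !subUset !sub.
Qed.

(** A constant that serves all four words in [traceform_word]; the successor ensures that it is at
    least 1. *)
Definition words4_const (d : nat) (w1 w2 w3 w4 : free_group d) : nat :=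
  (4 * (size (letters w1) + size (letters w2) + size (letters w3) +
        size (letters w4))).+1.

Lemma word_dist_SL2_uniform (R : realFieldType) (F : finFieldType) (r : R)
    (d : nat) (w1 w2 w3 w4 : free_group d) :
  0 < r -> r ^+ 2 = #|F|%:R ->
  pairwise_disjoint_words [:: w1; w2; w3; w4] ->
  w1 <> 1%g -> w2 <> 1%g -> w3 <> 1%g -> w4 <> 1%g ->
  let C : R := (words4_const w1 w2 w3 w4)%:R in
  forall g, g \in SL2 F ->
  `|#|SL2 F|%:R * word_dist R (SL2 F) (w1 * w2 * w3 * w4)%g g - 1|
    <= 11 * (103 * C ^+ 2) ^+ 2 / r.
Proof.
move=> r0 r2 /disjoint_words4[X1 [X [X3 [[u1 u2] [u3 u4] [u12 u34]]]]] n1 n2 n3 n4 C.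
move=> g gS; rewrite -mulgA.
have C1 : 1 <= C by rewrite ler1n.
have leC (n : nat) : (4 * n < words4_const w1 w2 w3 w4)%N -> (4 * n)%:R <= C.
  by move=> nC; rewrite ler_nat ltnW.
have tp1 : traceform_bound C (word_dist R (SL2 F) w1).
  by apply: traceform_word => //; apply: leC; rewrite ltnS leq_mul2l -!addnA leq_addr.
have tp2 : traceform_bound C (word_dist R (SL2 F) w2).
  by apply: traceform_word => //; apply: leC; rewrite ltnS leq_mul2l -addnA
    (addnC (size (letters w1))) -addnA leq_addr.
have tp3 : traceform_bound C (word_dist R (SL2 F) w3).
  by apply: traceform_word => //; apply: leC; rewrite ltnS leq_mul2l addnAC leq_addl.
have tp4 : traceform_bound C (word_dist R (SL2 F) w4).
  by apply: traceform_word => //; apply: leC; rewrite ltnS leq_mul2l leq_addl.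
have nu12 := conv_nearly_uniform r0 r2 C1 tp1 tp2 (word_dist_SL2_conj R (w1 * w2)%g)
  (fun g => word_dist_conv R u1 u2).
have nu34 := conv_nearly_uniform r0 r2 C1 tp3 tp4 (word_dist_SL2_conj R (w3 * w4)%g)
  (fun g => word_dist_conv R u3 u4).
apply: (conv_uniform (g := g) r0 r2 _ nu12 nu34) => //; try exact: word_dist_ge0.
  by have : 1 <= C ^+ 2 by [rewrite expr_ge1 // (le_trans _ C1)]; lra.
exact: (word_dist_conv R u12 u34 gS).
Qed.

Lemma Linfty_norm_ge0 (R : realFieldType) (gT : finGroupType) (G : {group gT})
  (f : gT -> R) : 0 <= Linfty_norm G f.
Proof. by rewrite mulr_ge0 ?ler0n // bigmax_ge_id. Qed.

(* Passage to PSL2 and the limit *)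
From mathcomp Require Import all_classical all_reals all_analysis.

Import Order.TTheory GRing.Theory Num.Theory.
Import numFieldNormedType.Exports.
Local Open Scope classical_set_scope.
Local Open Scope ring_scope.

Theorem corollary4p4 (R : realType) (d : nat) (w1 w2 w3 w4 : free_group d)
    (GF : nat -> finFieldType) :
  (forall q : nat, prime_power q -> #|GF q| = q) ->
  pairwise_disjoint_words [:: w1; w2; w3; w4] ->
  w1 <> 1%g -> w2 <> 1%g -> w3 <> 1%g -> w4 <> 1%g ->
  let w := (w1 * w2 * w3 * w4)%g in
  (fun q : nat =>
     Linfty_norm (PSL2 (GF q))
       (fun g => word_dist R (PSL2 (GF q)) w g - unif_dist R (PSL2 (GF q)) g))
    @ within prime_power \oo --> (0 : R).
Proof.
move=> GFq dw n1 n2 n3 n4 w.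
pose K : R := 11 * (103 * (words4_const w1 w2 w3 w4)%:R ^+ 2) ^+ 2.
have K0 : 0 <= K by rewrite mulr_ge0 // exprn_ge0 // mulr_ge0 // exprn_ge0.
apply/cvgrPdist_le => e e0; rewrite near_withinE.
(* Beyond this threshold K divided by the square root of q is at most e. *)
have := nbhs_infty_ger ((K / e) ^+ 2); apply: filterS => q qK pq.
have cq := GFq q pq; have q0 : (0 < q)%N.
  by rewrite -cq ltnW // card_finNzRing_gt1.
pose r := Num.sqrt (q%:R : R).
have r0 : 0 < r by rewrite sqrtr_gt0 ltr0n.
have r2 : r ^+ 2 = #|GF q|%:R by rewrite sqr_sqrtr ?cq.
rewrite sub0r normrN ger0_norm ?Linfty_norm_ge0 //.
apply: le_trans (_ : K / r <= e); last first.
  rewrite ler_pdivrMr // mulrC -ler_pdivrMr //.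
  by rewrite -(ger0_norm (divr_ge0 K0 (ltW e0))) -sqrtr_sqr ler_wsqrtr.
apply: Linfty_word_dist_quotient => [||g gS].
- exact: center_normal.
- by rewrite divr_ge0 // ltW.
exact: word_dist_SL2_uniform.
Qed.
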